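(* Let $M$ and $N$ be metrizable spaces with uncountable weight $\kappa$. (1) If $\kappa<\mathfrak{d}$ then $M$ is locally compact if and only if $\mathcal{K}(M)=_T[\kappa]^{<\omega}$. (2) If $M$ is either not locally compact or $\kappa\ge\mathfrak{d}$, then $\mathcal{K}(M)=_T\mathcal{K}(M')$, where $M'$ is the non-completely metrizable space $M\times\mathbb{Q}$. (3) If $\kappa<\aleph_\omega$ and both $M$ and $N$ are completely metrizable but not locally compact, then $\mathcal{K}(M)=_T\mathcal{K}(N)$. (4) The spaces $M'=\bigoplus_{n}H(\aleph_n)$ and $M''=H(\aleph_\omega)$ are both completely metrizable, not locally compact, and of weight $\aleph_\omega$, but $\mathcal{K}(M')\neq_T\mathcal{K}(M'')$ (that is, they are not Tukey equivalent).
   Context: A directed set is a (nonempty) partially ordered set in which every finite subset has an upper bound. For directed sets $P,Q$, write $P\ge_T Q$ if there is a map $\phi:P\to Q$ carrying every cofinal subset of $P$ to a cofinal subset of $Q$; $P=_TQ$ ($P,Q$ Tukey equivalent) means $P\ge_TQ$ and $Q\ge_TP$. For a space $X$, $\mathcal{K}(X)$ is the set of compact subsets of $X$ ordered by inclusion. $[\kappa]^{<\omega}$ is the set of finite subsets of $\kappa$ ordered by inclusion. $\mathfrak{d}$ is the minimal size of a cofinal subset of $\omega^\omega$ with the coordinatewise order. The weight of a space is the minimal size of a basis; $\bigoplus$ denotes topological disjoint sum over $n\in\omega$. For a cardinal $\kappa$, the metric hedgehog $H(\kappa)$ has underlying set $\{\ast\}\cup((0,1]\times\kappa)$ and metric $d(\ast,(x,\alpha))=x$,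 $d((x,\alpha),(x',\alpha))=|x-x'|$, and $d((x,\alpha),(x',\alpha'))=x+x'$ if $\alpha\ne\alpha'$. *)

(* Defs.v *)
From HB Require Import structures.
From mathcomp Require Import all_boot all_order all_algebra.
From mathcomp Require Import lra.
From mathcomp Require Import all_classical all_reals all_analysis.

Set Implicit Arguments.
Unset Strict Implicit.
Unset Printing Implicit Defensive.
Import Order.TTheory GRing.Theory Num.Theory.
Local Open Scope classical_set_scope.
Local Open Scope card_scope.
Local Open Scope ring_scope.

(* The case [A = set0] of [finite_ub] makes a directed set nonempty. *)
HB.mixin Record isDirected d P & Order.POrder d P := {
  finite_ub : forall A : set P, finite_set A -> exists x, ubound A x }.

#[short(type="directedType")]
HB.structure Definition Directed d := {P of isDirected d P & Order.POrder d P}.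

Definition cofinal d (P : porderType d) (C : set P) : Prop :=
  forall x, exists2 c, C c & (x <= c)%O.

Definition tukey_ge d d' (P : directedType d) (Q : directedType d') : Prop :=
  exists phi : P -> Q, forall C : set P, cofinal C -> cofinal (phi @` C).

Definition tukey_eq d d' (P : directedType d) (Q : directedType d') : Prop :=
  tukey_ge P Q /\ tukey_ge Q P.

(* A family of subsets of [T] as a type, ordered by inclusion. *)
Definition family T (F : set (set T)) : Type := {A : set T | A \in F}.

HB.instance Definition _ T (F : set (set T)) :=
  SubChoice.copy (family F) {A : set T | A \in F}.
HB.instance Definition _ T (F : set (set T)) :=
  [SubChoice_isSubPOrder of family F by <: with set_display].

Lemma family_leP T (F : set (set T)) (A B : family F) :
  (A <= B)%O <-> val A `<=` val B.
Proof. by rewrite leEsub; split => [/subsetPset|/subsetPset]. Qed.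

Lemma family_finite_ub T (F : set (set T)) :
  F set0 -> (forall A B, F A -> F B -> F (A `|` B)) ->
  forall S : set (family F), finite_set S -> exists x, ubound S x.
Proof.
move=> F0 FU S.
have base : exists x, ubound (set0 : set (family F)) x.
  by exists (Sub set0 (mem_set F0) : family F) => A [].
rewrite finite_seqP => -[s ->].
elim: s => [|A s [B ubB]]; first by rewrite set_nil.
have FAB : F (val A `|` val B).
  by apply: FU; rewrite -inE; exact: valP.
exists (Sub (val A `|` val B) (mem_set FAB) : family F) => C; rewrite /= inE => /orP[/eqP ->|sC].
  by apply/family_leP; exact: subsetUl.
by apply: (le_trans (ubB C sC)); apply/family_leP; exact: subsetUr.
Qed.

Definition compacts (M : topologicalType) : Type := family (@compact M).

HB.instance Definition _ (M : topologicalType) :=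
  Order.SubPOrder.on (compacts M).
HB.instance Definition _ (M : topologicalType) :=
  isDirected.Build set_display (compacts M)
    (family_finite_ub (@compact0 M) (@compactU M)).

Lemma finite_setU_imp T (A B : set T) :
  finite_set A -> finite_set B -> finite_set (A `|` B).
Proof. by move=> fA fB; rewrite finite_setU. Qed.

Definition finite_subsets (K : Type) : Type := family (@finite_set K).

HB.instance Definition _ (K : Type) := Order.SubPOrder.on (finite_subsets K).
HB.instance Definition _ (K : Type) :=
  isDirected.Build set_display (finite_subsets K)
    (family_finite_ub (@finite_set0 K) (@finite_setU_imp K)).

(* Cardinals are represented by arbitrary types of the given cardinality. *)
Definition type_card_le (K L : Type) : Prop := [set: K] #<= [set: L].

Definition type_card_lt (K L : Type) : Prop := type_card_le K L /\ ~ type_card_le L K.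

(* [K] has the least cardinality of a set satisfying [P]. *)
Definition least_card T (P : set (set T)) (K : Type) : Prop :=
  (exists2 A, P A & A #= [set: K]) /\ (forall A, P A -> [set: K] #<= A).

Definition has_weight (M : topologicalType) (K : Type) : Prop :=
  least_card (@basis M) K.

(* The order on [nat -> nat] is the coordinatewise one. *)
Definition is_dominating_number (D : Type) : Prop :=
  least_card (@cofinal _ (nat -> nat)) D.

Definition is_succ_card (K L : Type) : Prop :=
  type_card_lt K L /\ forall C : Type, type_card_lt K C -> type_card_le L C.

Fixpoint is_aleph (n : nat) (K : Type) : Prop :=
  if n is m.+1 then exists2 L : Type, is_aleph m L & is_succ_card L K
  else [set: K] #= [set: nat].

(* aleph_omega is the supremum of the aleph_n. *)
Definition is_aleph_omega (W : Type) : Prop :=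
  (forall n K, is_aleph n K -> type_card_le K W) /\
  (forall C : Type, (forall n K, is_aleph n K -> type_card_le K C) ->
     type_card_le W C).

Section metrizability.
Context {R : realType}.

Record is_metric T (d : T -> T -> R) : Prop := IsMetric {
  is_metric_eq0 : forall x y, d x y = 0 <-> x = y;
  is_metric_sym : forall x y, d x y = d y x;
  is_metric_triangle : forall y x z, d x z <= d x y + d y z }.

Definition compatible_metric (M : topologicalType) (d : M -> M -> R) : Prop :=
  is_metric d /\
  forall x, nbhs x = filter_from [set e | 0 < e] (fun e => [set y | d x y < e]).

Definition cauchy_seq T (d : T -> T -> R) (u : nat -> T) : Prop :=
  forall e, 0 < e -> exists N, forall m n,
    (N <= m)%N -> (N <= n)%N -> d (u m) (u n) < e.

End metrizability.

Definition metrizable (R : realType) (M : topologicalType) : Prop :=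
  exists d : M -> M -> R, compatible_metric d.

Definition completely_metrizable (R : realType) (M : topologicalType) : Prop :=
  exists2 d : M -> M -> R, compatible_metric d &
    forall u : nat -> M, cauchy_seq d u -> exists x : M, u @ \oo --> x.

(* The point [None] is the center of the hedgehog. *)
Definition hedgehog (R : realType) (K : Type) : Type :=
  option ({x : R | 0 < x <= 1} * K).

Section hedgehog_metric.
Context {R : realType} {K : Type}.
Implicit Types p q r : hedgehog R K.

Definition hedgehog_dist p q : R :=
  match p, q with
  | None, None => 0
  | None, Some (x, _) => val x
  | Some (x, _), None => val x
  | Some (x, a), Some (y, b) =>
      if pselect (a = b) then `|val x - val y| else val x + val y
  end.

Lemma hedgehog_distxx p : hedgehog_dist p p = 0.
Proof.
by case: p => [[x a]|] //=; case: pselect => //= ?; rewrite subrr normr0.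
Qed.

Lemma hedgehog_dist_eq0 p q : hedgehog_dist p q = 0 -> p = q.
Proof.
case: p q => [[[x x01] a]|] [[[y y01] b]|] //=.
- case: pselect => [ab|_] /=; last first.
    by move=> xy; have /andP[? _] := x01; have /andP[? _] := y01; exfalso; lra.
  move/normr0_eq0/subr0_eq => xy; congr (Some (_, _)) => //; exact: val_inj.
- by have /andP[? _] := x01 => ?; exfalso; lra.
- by have /andP[? _] := y01 => ?; exfalso; lra.
Qed.

Lemma hedgehog_dist_sym p q : hedgehog_dist p q = hedgehog_dist q p.
Proof.
case: p q => [[[x x01] a]|] [[[y y01] b]|] //=.
case: pselect => [ab|ab]; case: pselect => [ba|ba] /=.
- exact: distrC.
- by exfalso; apply: ba.
- by exfalso; apply: ab.
- exact: addrC.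
Qed.

Lemma hedgehog_dist_triangle q p r :
  hedgehog_dist p r <= hedgehog_dist p q + hedgehog_dist q r.
Proof.
case: p q r => [[[x x01] a]|] [[[y y01] b]|] [[[z z01] c]|] //=;
  repeat (case: pselect => ? /=); subst => //;
  try (move: x01 => /andP[? _]); try (move: y01 => /andP[? _]);
  try (move: z01 => /andP[? _]); try (repeat case: ger0P => ?); lra.
Qed.

HB.instance Definition _ := gen_eqMixin (hedgehog R K).
HB.instance Definition _ := gen_choiceMixin (hedgehog R K).
HB.instance Definition _ := @isMetric.Build R (hedgehog R K)
  hedgehog_dist hedgehog_distxx hedgehog_dist_eq0 hedgehog_dist_sym
  hedgehog_dist_triangle.

End hedgehog_metric.

(* Main.v *)
(** Write [P >= Q] for the Tukey order. A connection [(psi, phi)] with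
    [psi q <= p -> q <= phi p] witnesses [P >= Q], products are suprema, and
    everything reduces to comparing [K(M)] with the orders [kappa^{<omega}] (the
    finite subsets of [kappa]) and [omega^omega].

    Lower bounds: a closed discrete subset of size [kappa] gives
    [K(M) >= kappa^{<omega}], and a point without a compact neighbourhood gives
    [K(M) >= omega^omega]. If [M] is locally compact then
    [K(M) = kappa^{<omega}], and [kappa^{<omega} >= omega^omega] holds exactly
    when [kappa >= d]; this is (1).

    Upper bounds: if the compact sets are covered by [J]-many monotone images of
    [omega^omega] then [J^{<omega} * omega^omega >= K(M)]. For the rationals
    [J = omega_1] suffices, by a recursion on the Cantor-Bendixson rank, hence
    [K(M) >= K(M) * omega_1^{<omega} * omega^omega >= K(M) * K(Q) >= K(M * Q)],
    which is (2). For a complete [M] each compact set lies in the closure of a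
    countable subset of a dense set of size [kappa], and
    [cof([kappa]^omega) = kappa] for [kappa = aleph_n]; this gives (3).

    For (4), [kappa^{<omega} * omega^omega >= K(M')] with [kappa = aleph_omega],
    whereas [K(M'')] bounds all sequences in [kappa] by sequences of finite sets;
    a connection between the two would yield [cof([kappa]^omega) <= kappa]. *)

Require Import Defs.
From HB Require Import structures.
From mathcomp Require Import all_boot all_order all_algebra.
From mathcomp Require Import lra.
From mathcomp Require Import all_classical all_reals all_analysis.
From mathcomp Require wochoice.

Set Implicit Arguments.
Unset Strict Implicit.
Unset Printing Implicit Defensive.
Import Order.TTheory GRing.Theory Num.Theory.
Local Open Scope classical_set_scope.
Local Open Scope card_scope.
Local Open Scope ring_scope.

(** * Cardinals *)

Lemma sval_inj T (P : T -> Prop) (x y : {x | P x}) : sval x = sval y -> x = y.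
Proof. by case: x y => x Px [y Py] /= xy; exact: eq_exist. Qed.

Lemma card_leE T U (A : set T) (B : set U) :
  A #<= B <-> exists f : {x | A x} -> {y | B y}, injective f.
Proof.
split=> [/card_leP[f]|[f f_inj]].
  pose g (x : {x | A x}) : {y | B y} :=
    let y := f (SigSub (mem_set (svalP x))) in exist B (set_val y) (set_valP y).
  exists g => -[x Ax] [y Ay] [] /val_inj fxy; apply: eq_exist.
  by have := @inj _ _ _ f _ _ _ _ fxy; rewrite !inE => /(_ I I) [].
have gP (x : A) : sval (f (exist A (val x) (set_mem (valP x)))) \in B.
  by rewrite inE; exact: svalP.
apply/card_leP/injfunPex; exists (fun x => SigSub (gP x)) => //.
move=> x y _ _ [] fxy; apply: val_inj.
have [//] : exist A (val x) (set_mem (valP x)) = exist A (val y) (set_mem (valP y)).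
by apply: f_inj; exact: sval_inj.
Qed.

Lemma set_card_leP T (A : set T) (L : Type) :
  A #<= [set: L] <-> exists f : {x | A x} -> L, injective f.
Proof.
rewrite card_leE; split=> -[f f_inj].
  by exists (fun x => sval (f x)) => x y /sval_inj/f_inj.
by exists (fun x => exist _ (f x) I) => x y [] /f_inj.
Qed.

Lemma card_le_setP T (A : set T) (L : Type) :
  [set: L] #<= A <-> exists2 f : L -> T, injective f & forall x, A (f x).
Proof.
rewrite card_leE; split=> [[f f_inj]|[f f_inj fA]].
  exists (fun x => sval (f (exist _ x I))) => [x y fxy|x]; last exact: svalP.
  by have /f_inj[] := sval_inj fxy.
by exists (fun x => exist A (f (sval x)) (fA _)) => x y [] /f_inj/sval_inj.
Qed.

Lemma type_card_leP (K L : Type) :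
  type_card_le K L <-> exists f : K -> L, injective f.
Proof.
by rewrite /type_card_le card_le_setP; split=> [[f]|[f ?]]; exists f.
Qed.

Lemma card_le_sigP T (A : set T) (L : Type) :
  [set: L] #<= A <-> type_card_le L {x | A x}.
Proof.
rewrite card_le_setP type_card_leP; split=> [[f fI fA]|[f fI]].
  by exists (fun x => exist A (f x) (fA x)) => x y [/fI].
exists (fun x => sval (f x)) => [x y /sval_inj/fI //|x]; exact: svalP (f x).
Qed.

Lemma type_card_le_refl K : type_card_le K K.
Proof. exact: card_lexx. Qed.

Lemma type_card_le_trans L K M :
  type_card_le K L -> type_card_le L M -> type_card_le K M.
Proof. exact: card_le_trans. Qed.

Lemma sig_card_le T (A : set T) : type_card_le {x | A x} T.
Proof. by apply/type_card_leP; exists sval => x y; exact: sval_inj. Qed.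

(** A partial injection is coded by its graph. A maximal one, given by Zorn's lemma, is total or
    surjective, since otherwise a pair of missed points could be added. *)
Lemma type_card_le_total K L : type_card_le K L \/ type_card_le L K.
Proof.
pose P (F : set (K * L)) :=
  (forall x y y', F (x, y) -> F (x, y') -> y = y') /\
  (forall x x' y, F (x, y) -> F (x', y) -> x = x').
have [|F [[Ffun Finj] Fmax]] := @Zorn_bigcup _ P.
  move=> /= C CP Ctot; split.
    move=> x y y' [A CA Axy] [B CB Bxy].
    by have [AB|BA] := Ctot _ _ CA CB; [apply: (CP _ CB).1 Bxy; exact: AB
      |apply: (CP _ CA).1 Axy _; exact: BA].
  move=> x x' y [A CA Axy] [B CB Bxy].
  by have [AB|BA] := Ctot _ _ CA CB; [apply: (CP _ CB).2 Bxy; exact: AB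
    |apply: (CP _ CA).2 Axy _; exact: BA].
have [FK|/existsNP[x xF]] := pselect (forall x, exists y, F (x, y)).
  left; have [f fF] := choice FK; apply/type_card_leP; exists f => x x' fxx'.
  by apply: Finj (fF x) _; rewrite fxx'.
have [FL|/existsNP[y yF]] := pselect (forall y, exists x, F (x, y)).
  right; have [f fF] := choice FL; apply/type_card_leP; exists f => y y' fyy'.
  by apply: Ffun (fF y) _; rewrite fyy'.
exfalso; apply: (Fmax (F `|` [set (x, y)])).
  split; first by move=> z Fz; left.
  by move=> /(_ (x, y)) FU; apply: xF; exists y; apply: FU; right.
split.
  move=> u v v' [Fv|[-> ->]] [Fv'|[]]; first exact: Ffun Fv Fv'.
  - by move=> ? ?; subst; case: xF; exists v.
  - by case: xF; exists v'.
  - by move=> ->.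
move=> u u' v [Fv|[-> ->]] [Fv'|[]]; first exact: Finj Fv Fv'.
- by move=> ? ?; subst; case: yF; exists u.
- by case: yF; exists u'.
- by move=> ->.
Qed.

(** * Well-orders and minimal initial segments *)

Record strict_well_order T (lt : T -> T -> Prop) : Prop := StrictWellOrder {
  swo_wf : well_founded lt;
  swo_trans : forall y x z, lt x y -> lt y z -> lt x z;
  swo_total : forall x y, [\/ lt x y, x = y | lt y x] }.

Lemma exists_strict_well_order T : exists lt, @strict_well_order T lt.
Proof.
have [R Rwo] := wochoice.well_ordering_principle {classic T}.
have Rmin (A : set T) : A !=set0 -> exists2 m, A m & forall x, A x -> R m x.
  case=> a Aa; have [|m [[Am mA] _]] := Rwo [pred x : {classic T} | `[< A x >]].
    by exists a; apply/asboolP.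
  exists m; first by move/asboolP: Am.
  by move=> x Ax; apply: mA; apply/asboolP.
(* Antisymmetry: both points would be the least element of [{x, y}], which is unique. *)
have RA x y : R x y -> R y x -> x = y.
  move=> Rxy Ryx.
  have [|m [_ mU]] := Rwo [pred z : {classic T} | (z == x) || (z == y)].
    by exists x; rewrite inE eqxx.
  rewrite -(mU x) ?(mU y) //; split; rewrite ?inE ?eqxx ?orbT //.
    move=> z; rewrite inE => /orP[] /eqP -> //.
    by have [|m' /= -> mle] := Rmin [set y]; [exists y|exact: mle].
  move=> z; rewrite inE => /orP[] /eqP -> //.
  by have [|m' /= -> mle] := Rmin [set x]; [exists x|exact: mle].
have Rt x y : R x y \/ R y x.
  have [|m /= [] -> mle] := Rmin [set x; y]; first by exists x; left.
    by left; apply: mle; right.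
  by right; apply: mle; left.
exists (fun x y => ~ R y x); split.
- move=> a; apply: contrapT => na.
  have [|m Am mle] := Rmin [set a | ~ Acc (fun x y => ~ R y x) a].
    by exists a.
  by apply: Am; split => y yRm; apply: contrapT => /mle.
- move=> y x z yx zy xz.
  have [|m /=] := Rmin [set x; y; z]; first by exists x; left; left.
  have [yz|//] := Rt y z.
  have [xy|//] := Rt x y.
  case=> [[]|] -> mle.
  - by apply: zy; have -> : z = x by apply: RA => //; apply: mle; right.
  - by apply: yx; apply: mle; left; left.
  - by apply: zy; apply: mle; left; right.
- move=> x y; have [yx|] := pselect (R y x); last by constructor 1.
  have [xy|] := pselect (R x y); last by constructor 3.
  by constructor 2; exact: RA.
Qed.

(** Well-founded descent to the first point whose segment satisfies [P]. It yields initial ordinals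
    when [P] bounds the cardinality from below, and omega_1 when [P] is uncountability. *)
Lemma minimal_initial_segment T (P : set (set T)) : P setT ->
  exists (lt : T -> T -> Prop) (O : set T), [/\ strict_well_order lt, P O &
    forall a, O a -> ~ P [set b | lt b a]].
Proof.
have [lt ltwo] := exists_strict_well_order T.
move=> PT; exists lt.
have [[a Pa]|noP] := pselect (exists a, P [set b | lt b a]); last first.
  by exists setT; split=> // a _ Pa; apply: noP; exists a.
elim/(well_founded_ind (swo_wf ltwo)): a Pa => a IH Pa.
have [[b ba Pb]|noP] := pselect (exists2 b, lt b a & P [set c | lt c b]).
  exact: IH Pb.
exists [set b | lt b a]; split=> // b ba Pb.
by apply: noP; exists b.
Qed.

(** * Arithmetic of infinite cardinals *)

Lemma infinite_setTP K : infinite_set [set: K] <-> exists f : nat -> K, injective f.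
Proof. by rewrite infiniteP -type_card_leP. Qed.

Lemma type_card_le_prod K K' L L' : type_card_le K K' -> type_card_le L L' ->
  type_card_le (K * L) (K' * L').
Proof.
rewrite !type_card_leP => -[f fI] [g gI].
by exists (fun p => (f p.1, g p.2)) => -[x y] [x' y'] /= [/fI -> /gI ->].
Qed.

(* Hessenberg's theorem: a maximal partial injection [A * A -> A] has
   [A] equipotent to [K], since otherwise it extends to [A] together with a
   disjoint copy of [A]. *)
Lemma infinite_card_square K : infinite_set [set: K] -> type_card_le (K * K) K.
Proof.
move=> /infinite_setTP[i i_inj].
(* [G] stands for the graph of a map on [A * A]; the set [A = dom G] is read off the diagonal. *)
pose dom (G : set (K * K * K)) a := exists c, G (a, a, c).
pose G0 : set (K * K * K) :=
  [set x | exists n m, x = (i n, i m, i (pickle (n, m)))].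
pose P G :=
  [/\ forall p c c', G (p, c) -> G (p, c') -> c = c',
      forall p p' c, G (p, c) -> G (p', c) -> p = p',
      forall a b, dom G a -> dom G b -> exists c, G (a, b, c),
      forall a b c, G (a, b, c) -> [/\ dom G a, dom G b & dom G c] &
      G !=set0 -> G0 `<=` G].
have domS G G' a : G `<=` G' -> dom G a -> dom G' a.
  by move=> GG' [c Gc]; exists c; exact: GG'.
have [|G [[G1 G2 G3 G4 G5] Gmax]] := @Zorn_bigcup _ P.
  move=> /= C CP Ctot.
  have CU G : C G -> G `<=` \bigcup_(X in C) X by move=> CG x Gx; exists G.
  split.
  - move=> p c c' [A CA Axy] [B CB Bxy].
    have [AB|BA] := Ctot _ _ CA CB.
      by have [GB _ _ _ _] := CP _ CB; apply: GB Bxy; exact: AB.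
    by have [GA _ _ _ _] := CP _ CA; apply: GA Axy _; exact: BA.
  - move=> p p' c [A CA Axy] [B CB Bxy].
    have [AB|BA] := Ctot _ _ CA CB.
      by have [_ GB _ _ _] := CP _ CB; apply: GB Bxy; exact: AB.
    by have [_ GA _ _ _] := CP _ CA; apply: GA Axy _; exact: BA.
  - move=> a b [c [A CA Ac]] [c' [B CB Bc]].
    have [AB|BA] := Ctot _ _ CA CB.
      have [_ _ + _ _] := CP _ CB => /(_ a b) [||d Bd].
      + by exists c; exact: AB.
      + by exists c'.
      + by exists d, B.
    have [_ _ + _ _] := CP _ CA => /(_ a b) [||d Ad].
    + by exists c.
    + by exists c'; exact: BA.
    + by exists d, A.
  - move=> a b c [A CA Aabc]; have [_ _ _ + _] := CP _ CA.
    by move=> /(_ _ _ _ Aabc)[??]; split; apply: domS (CU _ CA) _.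
  - move=> [x [A CA Ax]]; have [_ _ _ _ +] := CP _ CA.
    by move=> AG0; apply: subset_trans (CU _ CA); apply: AG0; exists x.
have G0P : P G0.
  have pI := pcan_inj (@pickleK (nat * nat)%type).
  have G0dom n : dom G0 (i n) by exists (i (pickle (n, n))), n, n.
  split=> //.
  - by move=> p c c' [n [m [-> ->]]] [n' [m' [/i_inj -> /i_inj -> ->]]].
  - move=> p p' c [n [m [-> ->]]] [n' [m' [-> +]]].
    by move=> /i_inj /pI [-> ->].
  - move=> a b [c [n [m [-> _ _]]]] [c' [n' [m' [-> _ _]]]].
    by exists (i (pickle (n, n'))), n, n'.
  - by move=> a b c [n [m [-> -> ->]]]; split.
  - by move=> _ x.
have G0G : G0 `<=` G.
  have [/G5//|/set0P/negP/negPn/eqP G_0] := pselect (G !=set0).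
  exfalso; apply: (Gmax G0 _ G0P); rewrite G_0; split=> //.
  by move=> /(_ (i 0%N, i 0%N, i (pickle (0%N, 0%N)))) /=; apply; exists 0%N, 0%N.
pose A := {a | dom G a}.
have FE (a b : A) : exists c : A, G (sval a, sval b, sval c).
  have [c Gc] := G3 _ _ (svalP a) (svalP b).
  by have [_ _ dc] := G4 _ _ _ Gc; exists (exist _ c dc).
pose F a := projT1 (choice (FE a)).
have FG a b : G (sval a, sval b, sval (F a b)) := projT2 (choice (FE a)) b.
have svI (a b : A) : sval a = sval b -> a = b by exact: sval_inj.
have F_inj a b a' b' : F a b = F a' b' -> (a, b) = (a', b').
  move=> FF; have := G2 _ _ _ (FG a b); rewrite FF => /(_ _ (FG a' b')).
  by case=> /svI -> /svI ->.
have iA n : dom G (i n).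
  by exists (i (pickle (n, n))); apply: G0G; exists n, n.
(* Four distinct tags in [A], for embedding disjoint unions of copies of [A] into [A]. *)
pose e (s : bool * bool) : A := exist _ (i (pickle s)) (iA _).
have e_inj : injective e by move=> s t [/i_inj/(pcan_inj (@pickleK _))].
have [/type_card_leP[h hI]|/type_card_leP[h hI]] :=
  type_card_le_total A {a | ~ dom G a}; last first.
  (* If the complement of [A] embeds into [A], then so does [K], as a union of two tagged pieces,
     and [F] then carries [K * K] into [A]. *)
  pose g x : A := match pselect (dom G x) with
    | left dx => F (exist _ x dx) (e (true, true))
    | right dx => F (h (exist _ x dx)) (e (true, false)) end.
  have gI : injective g.
    move=> x y; rewrite /g.
    case: pselect => dx; case: pselect => dy /F_inj[] //.
    - by move=> _ /i_inj/(pcan_inj (@pickleK _)).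
    - by move=> _ /i_inj/(pcan_inj (@pickleK _)).
    - by move=> /hI[].
  apply/type_card_leP; exists (fun p => sval (F (g p.1) (g p.2))).
  by move=> [x y] [x' y'] /svI/F_inj[/gI -> /gI ->].
(* Otherwise [h] copies [A] off itself, and [dec] identifies [bool * A] with the enlarged set. Its
   square splits into four blocks: [v] keeps the old values on the old block and sends the other
   three, tagged, into the new copy. *)
pose dec (s : bool) (a : A) : K := if s then sval (h a) else sval a.
have decI s a t b : dec s a = dec t b -> s = t /\ a = b.
  rewrite /dec; case: s; case: t => hab.
  - by split=> //; apply/hI/sval_inj.
  - by case: (svalP (h a)); rewrite hab; exact: svalP.
  - by case: (svalP (h b)); rewrite -hab; exact: svalP.
  - by split=> //; exact: svI.
pose v (s t : bool) (a b : A) : bool * A :=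
  if s || t then (true, F (F a b) (e (s, t))) else (false, F a b).
have vI s t a b s' t' a' b' : v s t a b = v s' t' a' b' ->
    [/\ s = s', t = t', a = a' & b = b'].
  rewrite /v; case: ifP => st; case: ifP => st' // -[].
    by case/F_inj => /F_inj[-> ->] /i_inj/(pcan_inj (@pickleK _))[-> ->].
  by case/F_inj => -> ->; move: s t s' t' st st' => [] [] [] [].
pose G' : set (K * K * K) := [set x | exists s t a b,
   x = (dec s a, dec t b, dec (v s t a b).1 (v s t a b).2)].
have domG' s a : dom G' (dec s a).
  by eexists; exists s, s, a, a; reflexivity.
have GG' : G `<=` G'.
  move=> [[a b] c] Gabc; have [da db _] := G4 _ _ _ Gabc.
  exists false, false, (exist _ a da), (exist _ b db); rewrite /dec /=.
  by congr (_, _); apply: G1 Gabc (FG (exist _ a da) (exist _ b db)).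
exfalso; apply: (Gmax G').
  split=> // G'G.
  have [c /G'G Gc] := domG' true (e (true, true)).
  by have [d _ _] := G4 _ _ _ Gc; case: (svalP (h (e (true, true)))).
split.
- move=> p c c' [s [t [a [b [-> ->]]]]] [s' [t' [a' [b' [[+ +] ->]]]]].
  by move=> /decI[-> ->] /decI[-> ->].
- move=> p p' c [s [t [a [b [-> ->]]]]] [s' [t' [a' [b' [-> +]]]]].
  move=> /decI[v1 v2].
  have /vI[-> -> -> ->] // : v s t a b = v s' t' a' b'.
  by case: (v s t a b) (v s' t' a' b') v1 v2 => ? ? [? ?] /= -> ->.
- move=> a b [c [s [t [x [y [-> _ _]]]]]] [c' [s' [t' [x' [y' [-> _ _]]]]]].
  by eexists; exists s, s', x, x'; reflexivity.
- by move=> a b c [s [t [x [y [-> -> ->]]]]]; split.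
- by move=> _; apply: subset_trans GG'.
Qed.

Lemma finite_set_seq T (A : set T) : finite_set A ->
  exists s : seq T, forall x, A x <-> List.In x s.
Proof.
move=> /(@finite_seqP {classic T})[s ->]; exists s => x /=.
elim: s => [|y s IH] //=; rewrite inE; split.
  by move=> /orP[/eqP ->|/IH]; [left|right].
by move=> [->|/IH ->]; rewrite ?eqxx ?orbT.
Qed.

Lemma seq_finite_set T (s : seq T) : finite_set [set x | List.In x s].
Proof.
elim: s => [|x s IH]; first by apply: (@sub_finite_set _ _ set0).
apply: (@sub_finite_set _ _ ([set x] `|` [set y | List.In y s])).
  by move=> y /= [->|]; [left|right].
by rewrite finite_setU.
Qed.

(** A finite set is coded by a listing of it, and a listing by iterated pairing in [K]. *)
Lemma infinite_card_finite_subsets K : infinite_set [set: K] ->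
  type_card_le (finite_subsets K) K.
Proof.
move=> Kinf; have /type_card_leP[p pI] := infinite_card_square Kinf.
have /infinite_setTP[i iI] := Kinf.
pose enc := fix enc (s : seq K) :=
  if s is x :: s' then p (x, enc s') else i 0%N.
(* The length is recorded because [enc] does not mark the end of a sequence. *)
pose code s := p (i (size s), enc s).
have codeI : injective code.
  move=> s t /pI[/iI]; elim: s t => [|x s IH] [|y t] //= [/IH{}IH] /pI[-> /IH ->].
  by [].
have [g gP] : {g : finite_subsets K -> seq K &
    forall F x, val F x <-> List.In x (g F)}.
  by apply: (@choice _ _ (fun F s => forall x, val F x <-> List.In x s)) => F;
    apply: finite_set_seq; rewrite -inE; exact: valP.
apply/type_card_leP; exists (code \o g) => F G /codeI gFG.
apply/val_inj/seteqP; split=> x /gP; first by rewrite gFG => /gP.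
by rewrite -gFG => /gP.
Qed.

Lemma nat_card_le_infinite K : infinite_set [set: K] <-> type_card_le nat K.
Proof. exact: infiniteP. Qed.

Lemma infinite_card_prod_nat K : infinite_set [set: K] ->
  type_card_le (nat * K) K.
Proof.
move=> Kinf; apply: type_card_le_trans (infinite_card_square Kinf).
by apply: type_card_le_prod; [exact/nat_card_le_infinite|exact: type_card_le_refl].
Qed.

(** * Successor cardinals and the alephs *)

Lemma type_card_ltNge K L : type_card_lt K L <-> ~ type_card_le L K.
Proof.
split=> [[]//|LK]; split=> //.
by have [|/LK] := type_card_le_total K L.
Qed.

Lemma succ_card_leP L K C : is_succ_card L K -> ~ type_card_le K C ->
  type_card_le C L.
Proof.
move=> [_ LK] KC; have [//|LC] := type_card_le_total C L.
apply: contrapT => CL; apply: KC; apply: LK; exact/type_card_ltNge.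
Qed.

Lemma is_aleph_infinite n K : is_aleph n K -> infinite_set [set: K].
Proof.
rewrite nat_card_le_infinite; elim: n K => [|n IH] K /=.
  by rewrite card_eq_sym => /card_eqPle[].
by case=> L /IH nL [[LK _] _]; exact: type_card_le_trans LK.
Qed.

Lemma is_aleph_card_le n K L : is_aleph n K -> is_aleph n L -> type_card_le K L.
Proof.
elim: n K L => [|n IH] K L /=.
  by move=> /card_eqPle[Kn _]; rewrite card_eq_sym => /card_eqPle[nL _];
    exact: type_card_le_trans nL.
move=> [K' nK' [_ KK]] [L' nL' LL]; apply: KK; apply/type_card_ltNge => LK'.
have [[_ +] _] := LL; apply; apply: type_card_le_trans LK' _; exact: IH.
Qed.

Lemma exists_left_inverse T (A : set T) L (f : {x | A x} -> L) (x0 : T) :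
  injective f -> exists g : L -> T, forall x, g (f x) = sval x.
Proof.
move=> fI.
have /choice[g gP] y : exists x, forall z, f z = y -> x = sval z.
  have [[z <-]|nz] := pselect (exists z, f z = y).
    by exists (sval z) => w /fI ->.
  by exists x0 => z fz; case: nz; exists z.
by exists g => x; exact: gP.
Qed.

Lemma is_alephS_lt n K L : is_aleph n K -> is_aleph n.+1 L -> type_card_lt K L.
Proof.
move=> nK [K' nK' [[_ LK'] _]]; apply/type_card_ltNge => LK.
by apply: LK'; apply: type_card_le_trans LK _; exact: is_aleph_card_le nK nK'.
Qed.

Lemma is_aleph_le (A : nat -> Type) (hA : forall n, is_aleph n (A n)) m n :
  (m <= n)%N -> type_card_le (A m) (A n).
Proof.
elim: n => [|n IH]; first by rewrite leqn0 => /eqP ->; exact: type_card_le_refl.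
rewrite leq_eqVlt => /orP[/eqP ->|]; first exact: type_card_le_refl.
rewrite ltnS => /IH mn; apply: type_card_le_trans mn _.
by have [] := is_alephS_lt (hA n) (hA n.+1).
Qed.

(** If [K] were no aleph_n, induction would show every aleph_n to be at most [K], and hence also
    their supremum [W]. *)
Lemma lt_aleph_omega_aleph K W : is_aleph_omega W -> type_card_lt K W ->
  infinite_set [set: K] -> exists n, is_aleph n K.
Proof.
move=> [_ Wsup] [KW WK] /nat_card_le_infinite Kinf; apply: contrapT => Kn.
apply: WK; apply: Wsup; elim=> [|n IH] L /=.
  by move=> /card_eqPle[Ln _]; exact: type_card_le_trans Kinf.
move=> [L' nL' [_ LL]]; apply: LL; apply/type_card_ltNge => KL'.
(* [K] and [L'] are now equipotent, and the aleph property passes from [L'] to [K]. *)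
apply: Kn; exists n; have := IH _ nL'; clear -nL' KL' => L'K.
have KL : [set: K] #= [set: L'] by apply/card_eqPle; split.
case: n nL' => [|n] /=; first by apply: card_eq_trans.
move=> [M nM [[ML LM] Mmin]]; exists M => //; split; first split.
- exact: type_card_le_trans L'K.
- by move=> KM; apply: LM; exact: type_card_le_trans KM.
- by move=> C /Mmin; exact: type_card_le_trans.
Qed.

(** [L] is ordered like an initial ordinal: the order of the shortest segment into which [L] still
    embeds is pulled back along the embedding. *)
Lemma exists_small_segments L : exists lt : L -> L -> Prop,
  strict_well_order lt /\ forall a, ~ type_card_le L {b | lt b a}.
Proof.
have [|lt [B [[wf tr tot] /card_le_setP[g gI gB] Bseg]]] :=
  @minimal_initial_segment L (fun A => [set: L] #<= A).
  exact: card_lexx.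
exists (fun x y => lt (g x) (g y)); split; first split.
- move=> x; move: {2}(g x) (erefl (g x)) => y.
  elim/(well_founded_ind wf): y x => y IH x xy; split=> z; rewrite xy => zy.
  exact: IH zy _ erefl.
- by move=> y x z; exact: tr.
- move=> x y; have [?|/gI ?|?] := tot (g x) (g y).
  + by constructor 1.
  + by constructor 2.
  + by constructor 3.
- move=> a /type_card_leP[h hI]; apply: (Bseg (g a)) => //.
  apply/card_le_setP; exists (fun x => g (sval (h x))).
    by move=> x y /gI/sval_inj/hI.
  by move=> x /=; exact: svalP (h x).
Qed.

(* By induction: a countable subset of aleph_(n+1) is bounded. *)
Lemma is_aleph_countable_cofinal n K : is_aleph n K ->
  exists c : K -> nat -> K, forall s : nat -> K,
    exists k, forall i, exists j, c k j = s i.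
Proof.
elim: n K => [|n IH] K /=.
  rewrite card_eq_sym => /card_eqPle[/type_card_leP[i _] /type_card_leP[f fI]].
  have [|g gf] := @exists_left_inverse _ setT _ (f \o sval) (i 0%N).
    by move=> x y /fI; exact: sval_inj.
  exists (fun=> g) => s; exists (i 0%N) => k.
  by exists (f (s k)); exact: (gf (exist _ (s k) I)).
move=> [L nL sLK]; have [c cP] := IH _ nL.
have Linf := is_aleph_infinite nL.
have Kinf : infinite_set [set: K].
  move/nat_card_le_infinite: Linf => nL'; apply/nat_card_le_infinite.
  by have [[LK _] _] := sLK; exact: type_card_le_trans LK.
have [lt [[wf tr tot] seg]] := exists_small_segments K.
have segL a : exists j : {b | lt b a} -> L, injective j.
  by apply/type_card_leP; apply: succ_card_leP sLK (seg a).
pose j a := projT1 (cid (segL a)).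
have jI a : injective (j a) := projT2 (cid (segL a)).
have /choice[g gP] a := exists_left_inverse a (jI a).
(* The index [(a, k)] stands for the sequence [c k] in [L], decoded by [g a], the inverse of the
   embedding of the segment below [a]. *)
pose d (p : K * L) m : K := g p.1 (c p.2 m).
have /type_card_leP[q qI] : type_card_le (K * L) K.
  apply: type_card_le_trans (infinite_card_square Kinf).
  by apply: type_card_le_prod; [exact: type_card_le_refl|case: sLK => [[]]].
have [a0 _] := infinite_setN0 Kinf.
exists (fun k => if pselect (exists p, q p = k) is left h then d (projT1 (cid h))
  else fun _ => k) => s.
(* Every sequence is bounded: otherwise each [x] is at most [s (u x)] for some index [u x], and [K]
   embeds into [nat * L]. The tags [i 1] and [i 0] separate the cases of [x] strictly below
   [s (u x)] and equal to it. *)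
have [a sa] : exists a, forall i, lt (s i) a.
  apply: contrapT => /forallNP nob.
  have [[_ +] _] := sLK; apply.
  apply: type_card_le_trans (infinite_card_prod_nat Linf).
  have nob' a : exists i, ~ lt (s i) a by exact/existsNP.
  have [u uP] := choice nob'.
  have [l0 _] := infinite_setN0 Linf.
  have [i iI] := (infinite_setTP _).1 Linf.
  have /type_card_leP[r rI] := infinite_card_square Linf.
  pose F' x : nat * L := (u x,
    if pselect (lt x (s (u x))) is left h
    then r (i 1%N, j (s (u x)) (exist _ x h)) else r (i 0%N, i 0%N)).
  apply/type_card_leP; exists F' => x y; rewrite /F'; case.
  case: pselect => hx; case: pselect => hy uxy /rI.
  - by move: hx hy; rewrite -uxy => hx hy [/jI[]].
  - by case=> /iI.
  - by case=> /iI.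
  - move=> _.
    have uE z : ~ lt z (s (u z)) -> z = s (u z).
      by move=> hz; have [||] := tot z (s (u z)) => //; have := uP z.
    by rewrite (uE x hx) (uE y hy) uxy.
have [k kP] := cP (fun i => j a (exist _ (s i) (sa i))).
exists (q (a, k)); case: pselect => [h|[]]; last by exists (a, k).
case: cid => /= p /qI -> i; have [m cm] := kP i.
by exists m; rewrite /d /= cm gP.
Qed.

(** * Connections between relations *)

(* A Galois-Tukey connection: [E] is at least as complicated as [E']. *)
Definition tukey_conn X Y X' Y' (E : X -> Y -> Prop) (E' : X' -> Y' -> Prop) :=
  exists (psi : X' -> X) (phi : Y -> Y'),
    forall x y, E (psi x) y -> E' x (phi y).

Lemma tukey_conn_trans X1 Y1 X2 Y2 X3 Y3 (E2 : X2 -> Y2 -> Prop)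
    (E1 : X1 -> Y1 -> Prop) (E3 : X3 -> Y3 -> Prop) :
  tukey_conn E1 E2 -> tukey_conn E2 E3 -> tukey_conn E1 E3.
Proof.
move=> [psi [phi h]] [psi' [phi' h']].
by exists (psi \o psi'), (phi' \o phi) => x y /h /h'.
Qed.

(** If no [x] served a given [y], the points [p] with [phi p] not above [y] would be cofinal, but
    their image would not. *)
Lemma tukey_geP d d' (P : directedType d) (Q : directedType d') :
  tukey_ge P Q <->
  tukey_conn (fun x y : P => (x <= y)%O) (fun x y : Q => (x <= y)%O).
Proof.
split=> [[phi phiC]|[psi [phi h]]]; last first.
  exists phi => C Ccof y; have [c Cc /h yc] := Ccof (psi y).
  by exists (phi c) => //; exists c.
suff /choice[psi psiP] (y : Q) : exists x : P, forall p, (x <= p)%O -> (y <= phi p)%O.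
  by exists psi, phi => y p; exact: psiP.
apply: contrapT => /forallNP no.
have /phiC/(_ y)[_ [p yp <-]] : cofinal [set p | ~ (y <= phi p)%O].
  by move=> x; have /existsNP[p /not_implyP[xp yp]] := no x; exists p.
exact: yp.
Qed.

Definition tukey_prod X Y X' Y' (E : X -> Y -> Prop) (E' : X' -> Y' -> Prop)
  (p : X * X') (q : Y * Y') := E p.1 q.1 /\ E' p.2 q.2.

Lemma tukey_conn_prod X Y X1 Y1 X2 Y2 X3 Y3 (E : X -> Y -> Prop)
    (E1 : X1 -> Y1 -> Prop) (E2 : X2 -> Y2 -> Prop) (E3 : X3 -> Y3 -> Prop) :
  tukey_conn E E2 -> tukey_conn E1 E3 ->
  tukey_conn (tukey_prod E E1) (tukey_prod E2 E3).
Proof.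
move=> [psi [phi h]] [psi' [phi' h']].
exists (fun x => (psi x.1, psi' x.2)), (fun y => (phi y.1, phi' y.2)).
by move=> x y [/h ? /h' ?].
Qed.

(** A common upper bound in [P] of the two challenges answers both relations at once; this is why
    products act as suprema. *)
Lemma tukey_conn_directed_prod d (P : directedType d) X Y X' Y'
    (E : X -> Y -> Prop) (E' : X' -> Y' -> Prop) :
  tukey_conn (fun x y : P => (x <= y)%O) E ->
  tukey_conn (fun x y : P => (x <= y)%O) E' ->
  tukey_conn (fun x y : P => (x <= y)%O) (tukey_prod E E').
Proof.
move=> [psi [phi h]] [psi' [phi' h']].
have ub (p : X * X') : exists z : P, (psi p.1 <= z)%O /\ (psi' p.2 <= z)%O.
  have [|z zub] := finite_ub [set psi p.1; psi' p.2]; first exact: finite_set2.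
  by exists z; split; apply: zub; [left|right].
have [chi chiP] := choice ub.
exists chi, (fun y => (phi y, phi' y)) => p y chiy.
by split; [apply: h|apply: h'];
  apply: le_trans chiy; have [] := chiP p.
Qed.

Lemma tukey_conn_from_family T (F : set (set T)) X Y (E : X -> Y -> Prop)
    (psi : X -> set T) (phi : set T -> Y) :
  (forall x, F (psi x)) -> (forall x A, F A -> psi x `<=` A -> E x (phi A)) ->
  tukey_conn (fun A B : Defs.family F => (A <= B)%O) E.
Proof.
move=> Fpsi h; exists (fun x => Sub (psi x) (mem_set (Fpsi x)) : Defs.family F).
exists (phi \o val) => x A /family_leP /=.
by apply: h; rewrite -inE; exact: valP.
Qed.

Lemma tukey_conn_to_family T (F : set (set T)) X Y (E : X -> Y -> Prop)
    (psi : set T -> X) (phi : Y -> set T) :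
  (forall y, F (phi y)) -> (forall A y, F A -> E (psi A) y -> A `<=` phi y) ->
  tukey_conn E (fun A B : Defs.family F => (A <= B)%O).
Proof.
move=> Fphi h; exists (psi \o val), (fun y => Sub (phi y) (mem_set (Fphi y)) : Defs.family F).
move=> A y Ey; apply/family_leP; apply: h Ey.
by rewrite -inE; exact: valP.
Qed.

Notation compact_rel M := (fun A B : compacts M => (A <= B)%O).
Notation finite_rel K := (fun A B : finite_subsets K => (A <= B)%O).
Definition dominated (f g : nat -> nat) := forall n, (f n <= g n)%N.

Lemma finite_setP_family K (F : finite_subsets K) : finite_set (val F).
Proof. by rewrite -[finite_set _]/((@finite_set K) (val F)) -inE; exact: valP. Qed.

Lemma finite_rel_card_le K L : type_card_le L K ->
  tukey_conn (finite_rel K) (finite_rel L).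
Proof.
move=> /type_card_leP[i iI].
apply: (@tukey_conn_from_family _ _ _ _ _ (fun A : finite_subsets L => i @` val A)
  (fun B => insubd (Sub set0 (mem_set (finite_set0 L)) : finite_subsets L)
              (i @^-1` B))).
  by move=> A; apply: finite_image; exact: finite_setP_family.
move=> A B Bfin AB; apply/family_leP.
have iB : i @^-1` B \in (@finite_set L : set (set L)).
  by apply/mem_set; apply: finite_preimage => // x y _ _; exact: iI.
by rewrite insubdK // => x Ax; apply: AB; exists x.
Qed.

Lemma nat_bounded_finite (A : set nat) : finite_set A ->
  exists N, forall n, A n -> (n <= N)%N.
Proof.
move=> /finite_set_seq[s sA]; exists (\max_(i <- s) i)%N => n /sA ns.
elim: s {sA} ns => [|x s IH] //= [->|/IH h]; rewrite big_cons leq_max ?leqnn //.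
by rewrite h orbT.
Qed.

Lemma bigcup_finite_ind T I (P : set T -> Prop) (G : set I) (F : I -> set T) :
  P set0 -> (forall A B, P A -> P B -> P (A `|` B)) ->
  finite_set G -> (forall i, G i -> P (F i)) -> P (\bigcup_(i in G) F i).
Proof.
move=> P0 PU /finite_set_seq[s sG] PF.
have -> : \bigcup_(i in G) F i = \bigcup_(i in [set i | List.In i s]) F i.
  by congr (bigcup _ _); apply/seteqP; split=> i /sG.
have {PF} : forall i, List.In i s -> P (F i) by move=> i /sG /PF.
clear G sG; elim: s => [|i s IH] PF.
  by rewrite (_ : bigcup _ _ = set0) // -subset0 => x [].
rewrite (_ : bigcup _ _ = F i `|` \bigcup_(i in [set i | List.In i s]) F i).
  by apply: PU; [apply: PF; left|apply: IH => j js; apply: PF; right].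
apply/seteqP; split=> [x [j /= [<-|js] Fx]|x [Fx|[j js Fx]]].
- by left.
- by right; exists j.
- by exists i => //; left.
- by exists j => //; right.
Qed.

Lemma bigcup_finite_compact (M : topologicalType) I (G : set I) (F : I -> set M) :
  finite_set G -> (forall i, G i -> compact (F i)) ->
  compact (\bigcup_(i in G) F i).
Proof. by apply: bigcup_finite_ind; [exact: compact0|exact: compactU]. Qed.

Definition baire_covers (M : topologicalType) J (phi : J -> (nat -> nat) -> set M) :=
  [/\ forall j f, compact (phi j f),
      forall j f g, dominated f g -> phi j f `<=` phi j g &
      forall L, compact L -> exists G f, finite_set G /\
        L `<=` \bigcup_(j in G) phi j f].

Lemma baire_covers_conn (M : topologicalType) J phi : @baire_covers M J phi ->
  tukey_conn (tukey_prod (finite_rel J) dominated) (compact_rel M).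
Proof.
move=> [phiC phiM phiL].
have /choice[psi psiP] (L : set M) :
    exists p : finite_subsets J * (nat -> nat), compact L ->
      L `<=` \bigcup_(j in val p.1) phi j p.2.
  have [/phiL[G [f [Gfin LG]]]|nL] := pselect (compact L).
    by exists (Sub G (mem_set Gfin), f).
  by exists (Sub set0 (mem_set (finite_set0 J)), fun=> 0%N).
apply: (@tukey_conn_to_family _ _ _ _ _ psi
  (fun y => \bigcup_(j in val y.1) phi j y.2)).
  by move=> y; apply: bigcup_finite_compact => //; exact: finite_setP_family.
move=> L [G f] Lc [/= /family_leP LG Lf] x /(psiP L Lc)[j jG jx].
by exists j; [exact: LG|exact: phiM Lf _ jx].
Qed.

(** * Compactness in metric spaces *)

Lemma invSn_lt {R : realType} (e : R) : 0 < e -> exists n : nat, n.+1%:R^-1 < e.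
Proof.
move=> e0; have [n _ hn] := near_infty_natSinv_lt (PosNum e0).
by exists n; apply: hn => /=.
Qed.

Lemma invSn_le {R : realType} (m n : nat) : (m <= n)%N ->
  n.+1%:R^-1 <= m.+1%:R^-1 :> R.
Proof. by move=> mn; rewrite lef_pV2 ?posrE // ler_nat ltnS. Qed.

Lemma invSn_gt0 {R : realType} (n : nat) : 0 < n.+1%:R^-1 :> R.
Proof. by rewrite invr_gt0. Qed.

(** A filter that does not cluster at [q] has a member avoiding a neighbourhood of [q]; it then
    lives on finitely many of the [C n]. *)
Lemma compact_converging (M : topologicalType) (q : M) (C : nat -> set M) :
  (forall n, compact (C n)) ->
  (forall U, nbhs q U -> exists N, forall n, (N <= n)%N -> C n `<=` U) ->
  compact ([set q] `|` \bigcup_n C n).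
Proof.
move=> Cc Cq F FF FC.
have [qF|/existsNP[A /existsNP[U /not_implyP[FA /not_implyP[qU AU]]]]] :=
  pselect (cluster F q); first by exists q; split=> //; left.
have [N NU] := Cq U qU.
have : F (\bigcup_(n in `I_N) C n).
  apply: filterS (filterI FA FC) => x [Ax [xq|[n _ Cnx]]].
    by case: AU; exists x; split=> //; rewrite xq; exact: nbhs_singleton.
  exists n => //=; rewrite ltnNge; apply/negP => Nn; apply: AU.
  by exists x; split=> //; exact: NU Cnx.
move=> /(bigcup_finite_compact (finite_II N) (fun n _ => Cc n)).
by move=> [x [[n _ Cnx] xF]]; exists x; split=> //; right; exists n.
Qed.

Section Metric.
Context {R : realType} {M : topologicalType} {d : M -> M -> R}.
Hypothesis dM : compatible_metric d.

Lemma distxx x : d x x = 0.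
Proof. by have [[dE _ _] _] := dM; apply/dE. Qed.

Lemma dist_sym x y : d x y = d y x.
Proof. by have [[]] := dM. Qed.

Lemma dist_tri y x z : d x z <= d x y + d y z.
Proof. by have [[]] := dM. Qed.

Lemma dist_eq0 x y : d x y = 0 -> x = y.
Proof. by have [[dE _ _] _] := dM => /dE. Qed.

Lemma dist_ge0 x y : 0 <= d x y.
Proof. by have := dist_tri y x x; rewrite distxx (dist_sym y x); lra. Qed.

Lemma dist_gt0 x y : x <> y -> 0 < d x y.
Proof.
move=> xy; rewrite lt_neqAle dist_ge0 andbT eq_sym.
by apply/eqP => /dist_eq0.
Qed.

Lemma nbhs_distP x (U : set M) :
  nbhs x U <-> exists2 e : R, 0 < e & forall y, d x y < e -> U y.
Proof. by have [_ ->] := dM; split=> -[e e0 h]; exists e. Qed.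

Lemma open_distP (U : set M) :
  open U <-> forall x, U x -> exists2 e : R, 0 < e & forall y, d x y < e -> U y.
Proof.
rewrite openE; split=> h x /h; rewrite /interior => /nbhs_distP //.
Qed.

Lemma open_dist_ball x (e : R) : open [set y | d x y < e].
Proof.
apply/open_distP => y /= xy; exists (e - d x y); first by lra.
by move=> z yz; have := dist_tri y x z; lra.
Qed.

Lemma closed_distP (C : set M) : (forall x, ~ C x ->
  exists2 e : R, 0 < e & forall y, d x y < e -> ~ C y) -> closed C.
Proof. by move=> h; rewrite -[C]setCK; apply/open_closedC/open_distP. Qed.

Lemma closed_dist_ge x (e : R) : closed [set y | e <= d x y].
Proof.
rewrite -[X in closed X]setCK; apply: open_closedC.
rewrite (_ : ~` _ = [set y | d x y < e]); first exact: open_dist_ball.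
by apply/seteqP; split=> y /=; [move/negP; rewrite -ltNge|
  rewrite ltNge => /negP].
Qed.

Lemma closed_dist_le x (e : R) : closed [set y | d x y <= e].
Proof.
apply: closed_distP => y /= /negP; rewrite -ltNge => xy.
exists (d x y - e); first by lra.
by move=> z yz /=; have := dist_tri z x y; rewrite (dist_sym z y); lra.
Qed.

Lemma metric_hausdorff_space : hausdorff_space M.
Proof.
move=> p q pq; apply: contrapT => /dist_gt0 pq0.
have [||x [/= px qx]] := pq [set y | d p y < d p q / 2] [set y | d q y < d p q / 2].
- by apply/nbhs_distP; exists (d p q / 2) => //; lra.
- by apply/nbhs_distP; exists (d p q / 2) => //; lra.
by have := dist_tri x p q; rewrite (dist_sym x q); lra.
Qed.

Lemma compact_metric_closed (C : set M) : compact C -> closed C.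
Proof. by apply: compact_closed; exact: metric_hausdorff_space. Qed.

Lemma cvg_distP (u : nat -> M) x : u @ \oo --> x <->
  forall e : R, 0 < e -> exists N, forall n, (N <= n)%N -> d x (u n) < e.
Proof.
split=> [ux e e0|h U /nbhs_distP[e /h[N NU] eU]].
  have [|N _ NU] := ux [set y | d x y < e]; first by apply/nbhs_distP; exists e.
  by exists N => n Nn; exact: NU.
by exists N => // n /= /NU /eU.
Qed.

(** Compactness is applied to the filter generated by the tails of those terms that lie in [L]. *)
Lemma compact_cluster_seq (L : set M) (u : nat -> M) : compact L ->
  (forall N, exists2 n, (N <= n)%N & L (u n)) ->
  exists2 x, L x & forall e : R, 0 < e -> forall N, exists n,
    [/\ (N <= n)%N, L (u n) & d x (u n) < e].
Proof.
move=> Lc uL.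
pose F := filter_from [set: nat] (fun N => [set x | exists2 n, (N <= n)%N & x = u n /\ L (u n)]).
have FF : ProperFilter F.
  apply: filter_from_proper; last first.
    by move=> N _; have [n Nn Ln] := uL N; exists (u n), n.
  apply: filter_from_filter; first by exists 0%N.
  move=> i j _ _; exists (maxn i j) => // x [n]; rewrite geq_max => /andP[? ?] ?.
  by split; exists n.
have [|x [Lx xF]] := Lc F FF; first by exists 0%N => // x [n _ [->]].
exists x => // e e0 N.
have [||y [[n Nn [-> Ln]] xn]] :=
    xF [set x | exists2 n, (N <= n)%N & x = u n /\ L (u n)] [set y | d x y < e].
- by exists N.
- by apply/nbhs_distP; exists e.
- by exists n.
Qed.

Lemma cauchy_cluster_cvg (u : nat -> M) (x : M) : cauchy_seq d u ->
  (forall e : R, 0 < e -> forall N, exists n, (N <= n)%N /\ d x (u n) < e) ->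
  u @ \oo --> x.
Proof.
move=> uc xP; apply/cvg_distP => e e0; have e2 : 0 < e / 2 by lra.
have [N NP] := uc _ e2; exists N => n Nn; have [m [Nm xm]] := xP _ e2 N.
by have := NP _ _ Nm Nn; have := dist_tri (u m) x (u n); lra.
Qed.

(** When no finite set of centres suffices, points are picked one after the other at distance at
    least [e] from all earlier ones, which [l n] lists. *)
Lemma exists_separated_seq (C : set M) (e : R) :
  ~ (exists s : seq M, forall x, C x -> exists2 y, List.In y s & d y x < e) ->
  exists u : nat -> M, (forall n, C (u n)) /\
    forall i j, (i < j)%N -> e <= d (u i) (u j).
Proof.
move=> /forallNP no.
have /choice[g gP] (s : seq M) : exists x, C x /\ forall y, List.In y s -> e <= d y x.
  have /existsNP[x /not_implyP[Lx xs]] := no s; exists x; split=> // y ys.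
  by rewrite leNgt; apply/negP => yx; apply: xs; exists y.
pose l := fix l n := if n is m.+1 then g (l m) :: l m else [::].
have ul i j : (i < j)%N -> List.In (g (l i)) (l j).
  elim: j => // j IH; rewrite ltnS leq_eqVlt => /orP[/eqP ->|/IH]; first by left.
  by right.
exists (fun n => g (l n)); split=> [n|i j /ul]; first by have [] := gP (l n).
by have [_] := gP (l j); apply.
Qed.

Lemma compact_separated_seq (L : set M) (u : nat -> M) (e : R) : compact L ->
  0 < e -> (forall i j, (i < j)%N -> e <= d (u i) (u j)) ->
  ~ forall N, exists2 n, (N <= n)%N & L (u n).
Proof.
move=> Lc e0 ue uL; have [x Lx xP] := compact_cluster_seq Lc uL.
have e2 : 0 < e / 2 by lra.
have [i [_ _ xi]] := xP _ e2 0%N; have [j [ij _ xj]] := xP _ e2 i.+1.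
by have := ue _ _ ij; have := dist_tri x (u i) (u j); rewrite (dist_sym (u i) x); lra.
Qed.

Lemma ultra_bigcup_seq (F : set_system M) (I : Type) (s : seq I) (B : I -> set M) :
  UltraFilter F -> F (\bigcup_(i in [set i | List.In i s]) B i) ->
  exists i, F (B i).
Proof.
move=> FU; elim: s => [|i s IH] FB.
  by have [x [j []]] := @filter_ex _ F _ _ FB.
have [?|FC] := in_ultra_setVsetC (B i) FU; first by exists i.
apply: IH; apply: filterS (filterI FB FC) => x [[j /= [<- //|js] Bx] _].
by exists j.
Qed.

(** An ultrafilter on [C] contains one ball from the finite cover of each radius. Points [u n] taken
    in the first [n + 1] of these balls form a Cauchy sequence, and the ultrafilter converges to its
    limit. *)
Lemma complete_totally_bounded_compact (C : set M) :
  (forall e : R, 0 < e -> exists s : seq M,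
     forall x, C x -> exists2 y, List.In y s & d y x < e) ->
  (forall u, cauchy_seq d u -> (forall n, C (u n)) ->
     exists2 x, C x & u @ \oo --> x) ->
  compact C.
Proof.
move=> Ctb Cc; rewrite compact_ultra => F FU FC.
have /choice[y yP] (n : nat) : exists y, F [set x | d y x < n.+1%:R^-1].
  have [s sP] := Ctb _ (@invSn_gt0 R n).
  apply: (@ultra_bigcup_seq _ _ s (fun y => [set x | d y x < n.+1%:R^-1])) => //.
  by apply: filterS FC => x /sP[y ys yx]; exists y.
have /choice[u uP] (n : nat) : exists x, C x /\ forall i, (i <= n)%N -> d (y i) x < i.+1%:R^-1.
  suff : F [set x | C x /\ forall i, (i <= n)%N -> d (y i) x < i.+1%:R^-1].
    by move/filter_ex.
  elim: n => [|n IH].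
    by apply: filterS (filterI FC (yP 0%N)) => x [Cx yx]; split=> // -[].
  apply: filterS (filterI IH (yP n.+1)) => x [[Cx yx] yx']; split=> // i.
  by rewrite leq_eqVlt => /orP[/eqP -> //|]; rewrite ltnS => /yx.
have yu i n : (i <= n)%N -> d (y i) (u n) < i.+1%:R^-1.
  by have [_] := uP n; apply.
have [|n|x Cx /cvg_distP ux] := Cc u.
- move=> e e0; have [N Ne] := invSn_lt (divr_gt0 e0 (ltr0Sn _ _) : 0 < e / 2).
  exists N => m n /yu Nm /yu Nn.
  have := dist_tri (y N) (u m) (u n); rewrite (dist_sym (u m) (y N)).
  by move: (N.+1%:R^-1) Ne Nm Nn => r ? ? ? ?; lra.
- by have [] := uP n.
exists x; split=> //= U /nbhs_distP[e e0 eU].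
have [N Ne] := invSn_lt (divr_gt0 e0 (ltr0Sn _ _) : 0 < e / 4).
have [m mP] := ux (e / 4) (divr_gt0 e0 (ltr0Sn _ _)).
apply: filterS (yP N) => z /= yz; apply: eU.
have := mP (maxn m N) (leq_maxl _ _); have := yu _ _ (leq_maxr m N).
set w := u _; have := dist_tri w x (y N); have := dist_tri (y N) x z.
rewrite (dist_sym w (y N)); move: (N.+1%:R^-1) Ne yz => r ? ? ? ? ? ?.
by lra.
Qed.

(** Either [C] is not totally bounded and contains a separated sequence, or it contains a Cauchy
    sequence without a limit in [C]. Neither returns infinitely often to a compact set. *)
Lemma closed_noncompact_seq (C : set M) : closed C -> ~ compact C ->
  exists u : nat -> M, (forall n, C (u n)) /\
    forall L, compact L -> exists N, forall n, L (u n) -> (n <= N)%N.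
Proof.
move=> Cc; have bnd (u : nat -> M) L : ~ (forall N, exists2 n, (N <= n)%N & L (u n)) ->
    exists N, forall n, L (u n) -> (n <= N)%N.
  move=> /existsNP[N /forall2NP NP]; exists N => n Ln.
  by have [/negP|//] := NP n; rewrite -ltnNge => /ltnW.
have [tb|] := pselect (forall e : R, 0 < e -> exists s : seq M,
     forall x, C x -> exists2 y, List.In y s & d y x < e); last first.
  move=> /existsNP[e /not_implyP[e0 /exists_separated_seq[u [uC ue]]]] _.
  by exists u; split=> // L Lc; exact/bnd/(compact_separated_seq Lc e0 ue).
move=> nC; have /existsNP[u /not_implyP[uc /not_implyP[uC nu]]] :
    ~ forall u, cauchy_seq d u -> (forall n, C (u n)) ->
     exists2 x, C x & u @ \oo --> x.
  by move=> /(complete_totally_bounded_compact tb).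
exists u; split=> // L Lc; apply: bnd => uL; apply: nu.
have [x Lx xP] := compact_cluster_seq Lc uL.
have ux : u @ \oo --> x.
  apply: cauchy_cluster_cvg => // e e0 N.
  by have [m [? _ ?]] := xP e e0 N; exists m.
exists x => //; apply: (closed_cvg C) ux => //.
by apply: nearW.
Qed.

End Metric.

(** * Local compactness and weight *)

(** If no finite subfamily sufficed, the parts of [L] left uncovered would generate a filter, and
    near a cluster point in [L] a single member contradicts this. *)
Lemma compact_finite_subcover (M : topologicalType) U (C : U -> set M) (L : set M) :
  compact L -> (forall x, L x -> exists u, nbhs x (C u)) ->
  exists s : seq U, forall x, L x -> exists u, List.In u s /\ C u x.
Proof.
move=> Lc LC; apply: contrapT => /forallNP no.
pose B s := [set x | L x /\ forall u, List.In u s -> ~ C u x].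
have FF : ProperFilter (filter_from [set: seq U] B).
  apply: filter_from_proper; last first.
    move=> s _; have /existsNP[x /not_implyP[Lx /forallNP xs]] := no s.
    by exists x; split=> // u us Cux; apply: (xs u).
  apply: filter_from_filter; first by exists [::].
  move=> s t _ _; exists (s ++ t) => // x [Lx xst].
  by split; split=> // u us; apply: xst; apply/List.in_app_iff; [left|right].
have [|x [Lx xF]] := Lc _ FF; first by exists [::] => // x [].
have [u xu] := LC x Lx.
have [||y [[_ +] Cuy]] := xF (B [:: u]) (C u); [by exists [:: u]|by []|].
by move=> /(_ u (or_introl erefl)).
Qed.

Lemma uncountable_weight_nonempty (M : topologicalType) K : has_weight M K ->
  ~ countable [set: K] -> [set: M] !=set0.
Proof.
move=> [[B _ BK] _] Kunc; apply/set0P/eqP => M0; apply: Kunc.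
move: BK => /card_eqPle[_ KB].
apply: card_le_trans KB _; apply: finite_set_countable.
apply: (@sub_finite_set _ _ [set set0; setT]); last exact: finite_set2.
by move=> V _; left; rewrite /= -subset0 -M0.
Qed.

Section MetricTukey.
Context {R : realType} {M : topologicalType} {d : M -> M -> R}.
Hypothesis dM : compatible_metric d.

(** At a point [x] without compact neighbourhood, the ball of radius [1/(n+1)] contains a sequence
    [u n] meeting each compact set finitely often. The terms of each [u n] up to [f n], together
    with [x], form a compact set; the last index at which a compact set meets [u n] bounds [f n]. *)
Lemma not_locally_compact_dominated : ~ locally_compact [set: M] ->
  tukey_conn (compact_rel M) dominated.
Proof.
move=> nlc.
have [x xP] : exists x : M, forall U, nbhs x U -> closed U -> ~ compact U.
  apply: contrapT => /forallNP no; apply: nlc => x _.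
  have /existsNP[U /not_implyP[xU /not_implyP[Uc /contrapT Ucpt]]] := no x.
  by exists U => //; apply: (@filterS _ _ _ U) xU.
have /choice[u uP] (n : nat) : exists u : nat -> M,
    (forall m, d x (u m) <= n.+1%:R^-1) /\
    forall L, compact L -> exists N, forall m, L (u m) -> (m <= N)%N.
  have Bc := @closed_dist_le _ _ _ dM x n.+1%:R^-1.
  apply: (closed_noncompact_seq dM Bc); apply: xP => //.
  by apply/(nbhs_distP dM); exists n.+1%:R^-1; [exact: (@invSn_gt0 R)|move=> y /ltW].
have /choice[b bP] (L : set M) : exists b : nat -> nat, compact L ->
    forall n m, L (u n m) -> (m <= b n)%N.
  have [Lc|nL] := pselect (compact L); last by exists (fun=> 0%N).
  have /choice[b bP] n : exists N, forall m, L (u n m) -> (m <= N)%N.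
    by have [_] := uP n; exact.
  by exists b.
apply: (@tukey_conn_from_family _ _ _ _ _
  (fun f => [set x] `|` \bigcup_n (u n @` [set m | (m <= f n)%N])) b).
- move=> f; apply: compact_converging => [n|U /(nbhs_distP dM)[e e0 eU]].
    apply: finite_compact; apply: finite_image.
    by apply: (@sub_finite_set _ _ `I_(f n).+1) => // m; rewrite /= ltnS.
  have [N Ne] := invSn_lt e0; exists N => n Nn _ [m _ <-]; apply: eU.
  have [+ _] := uP n => /(_ m); have := @invSn_le R _ _ Nn.
  by move: (N.+1%:R^-1) (n.+1%:R^-1) Ne => r s ? ? ?; lra.
- move=> f L Lc fL n; apply: bP => //; apply: fL; right.
  by exists n => //; exists (f n) => //=.
Qed.

(** In a metric space the hypothesis says that [S] is finite-to-one with closed discrete range. *)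
Lemma closed_discrete_finite_rel K (S : K -> M) :
  (forall L, compact L -> finite_set [set a | L (S a)]) ->
  tukey_conn (compact_rel M) (finite_rel K).
Proof.
move=> SP.
have /choice[phi phiP] (L : set M) : exists G : finite_subsets K, compact L ->
    forall a, L (S a) -> val G a.
  have [/SP fin|nL] := pselect (compact L).
    by exists (Sub [set a | L (S a)] (mem_set fin) : finite_subsets K).
  by exists (Sub set0 (mem_set (finite_set0 K)) : finite_subsets K).
apply: (@tukey_conn_from_family _ _ _ _ _ (fun F : finite_subsets K => S @` val F) phi).
  by move=> F; apply: finite_compact; apply: finite_image; exact: finite_setP_family.
move=> F L Lc FL; apply/family_leP => a Fa; apply: phiP => //.
by apply: FL; exists a.
Qed.

Lemma infinite_set_seq T (A : set T) : ~ finite_set A ->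
  exists2 f : nat -> T, injective f & forall n, A (f n).
Proof. by move/infiniteP/card_le_setP. Qed.

Lemma separated_closed_discrete K (S : K -> M) (e : R) : 0 < e ->
  (forall a b, a <> b -> e <= d (S a) (S b)) ->
  forall L, compact L -> finite_set [set a | L (S a)].
Proof.
move=> e0 Se L Lc; apply: contrapT => /infinite_set_seq[i iI iL].
apply: (compact_separated_seq dM Lc e0 (u := S \o i)); last first.
  by move=> N; exists N => //=; exact: iL.
by move=> m n mn; apply: Se => /iI mnE; rewrite mnE ltnn in mn.
Qed.

(** Zorn's lemma. The radius varies with the point so that it can follow the size of compact balls
    in a locally compact space. *)
Lemma exists_maximal_separated (r : M -> R) : (forall x, 0 < r x) ->
  exists S : set M,
    (forall x y, S x -> S y -> x <> y -> r x <= d x y /\ r y <= d x y) /\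
    forall y, exists2 x, S x & d x y < r x \/ d x y < r y.
Proof.
move=> r0.
pose P (S : set M) := forall x y, S x -> S y -> x <> y -> r x <= d x y /\ r y <= d x y.
have [|S [SP Smax]] := @Zorn_bigcup _ P.
  move=> /= C CP Ctot x y [A CA Ax] [B CB By].
  have [AB|BA] := Ctot _ _ CA CB.
    by apply: (CP _ CB) => //; exact: AB.
  by apply: (CP _ CA) => //; exact: BA.
exists S; split=> // y; apply: contrapT => /forall2NP no.
have far x : S x -> r x <= d x y /\ r y <= d x y.
  by move=> Sx; have [//|/not_orP[/negP + /negP +]] := no x; rewrite -!leNgt.
apply: (Smax (S `|` [set y])).
  split; first by move=> z; left.
  move=> /(_ y (or_intror erefl)) /far [_]; rewrite (distxx dM).
  by rewrite leNgt r0.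
move=> a b [Sa|->] [Sb|->] ab //; first exact: SP.
- exact: far.
- by rewrite (dist_sym dM); have [? ?] := far _ Sb.
Qed.

(** Balls of radius [1/(n+1)] around a dense family form a basis. *)
Lemma dense_weight_le J (D : J -> M) K : has_weight M K ->
  (forall x (e : R), 0 < e -> exists j, d x (D j) < e) -> type_card_le K (J * nat).
Proof.
move=> [_ Kmin] Dd.
pose U (p : J * nat) := [set y | d (D p.1) y < p.2.+1%:R^-1].
have : [set: K] #<= range U.
  apply: Kmin; split=> [_ [p _ <-]|x V /(nbhs_distP dM)[e e0 eV]].
    exact: (open_dist_ball dM).
  have e2 : 0 < e / 2 by lra.
  have [n ne] := invSn_lt e2; have [j xj] := Dd x _ (@invSn_gt0 R n).
  exists (U (j, n)); first by split; [exists (j, n)|rewrite /U /= (dist_sym dM)].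
  move=> y; rewrite /U /= => jy; apply: eV.
  have := dist_tri dM (D j) x y.
  by move: (n.+1%:R^-1) ne xj jy => s ? ? ? ?; lra.
by move=> /card_le_trans; apply; exact: card_image_le.
Qed.

(** If maximal [1/(n+1)]-separated sets embedded into [L] for all [n], their union would be dense
    and of size at most [L], forcing the weight down to [L]. *)
Lemma large_separated_set K L : has_weight M K -> infinite_set [set: L] ->
  ~ type_card_le K L ->
  exists (e : R) (S : set M), [/\ 0 < e,
    forall x y, S x -> S y -> x <> y -> e <= d x y & ~ type_card_le {x | S x} L].
Proof.
move=> MK Linf KL; apply: contrapT => no; apply: KL.
have /choice[S SP] (n : nat) := @exists_maximal_separated (fun=> n.+1%:R^-1)
  (fun=> @invSn_gt0 R n).
have SL n : exists f : {x | S n x} -> L, injective f.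
  apply/type_card_leP; apply: contrapT => nSL; apply: no.
  exists n.+1%:R^-1, (S n); split=> //.
  by move=> x y Sx Sy xy; have [+ _] := SP n => /(_ x y Sx Sy xy)[].
pose J := {p : nat * M | S p.1 p.2}.
have JL : type_card_le J L.
  apply: type_card_le_trans (infinite_card_prod_nat Linf).
  pose f n := projT1 (cid (SL n)).
  have fI n : injective (f n) := projT2 (cid (SL n)).
  apply/type_card_leP; exists (fun p : J => ((sval p).1, f _ (exist (S (sval p).1) _ (svalP p)))).
  move=> [[n x] p] [[m y] q] /= [nm]; subst m => /fI[xy].
  by apply: eq_exist; rewrite xy.
apply: type_card_le_trans (infinite_card_square Linf).
apply: (@type_card_le_trans (J * nat)); last first.
  by apply: type_card_le_prod => //; exact/nat_card_le_infinite.
apply: (@dense_weight_le _ (fun p : J => (sval p).2)) => // x e e0.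
have [n ne] := invSn_lt e0; have [_ /(_ x)[y Sy xy]] := SP n.
exists (exist _ (n, y) Sy) => /=; rewrite (dist_sym dM).
by case: xy => xy; exact: lt_trans xy ne.
Qed.

(** For each [n] finitely many [D i] approximate [L] up to [1/(n+1)]; the sequence runs through all
    these finite lists, padded with [i0]. *)
Lemma compact_countable_approximation I (D : I -> M) (i0 : I) (L : set M) :
  compact L ->
  (forall x (e : R), L x -> 0 < e -> exists i, d x (D i) < e) ->
  exists s : nat -> I, forall x (e : R), L x -> 0 < e -> exists n, d x (D (s n)) < e.
Proof.
move=> Lc LD.
have /choice[s sP] (n : nat) : exists s : seq I, forall x, L x ->
    exists i, List.In i s /\ d (D i) x < n.+1%:R^-1.
  apply: compact_finite_subcover Lc _ => x Lx.
  have [i xi] := LD x _ Lx (@invSn_gt0 R n).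
  exists i; apply: open_nbhs_nbhs; split; first exact: (open_dist_ball dM).
  by rewrite /= (dist_sym dM).
exists (fun k => if unpickle k is Some (n, m) then nth i0 (s n) m else i0).
move=> x e Lx e0; have [n ne] := invSn_lt e0; have [i [si ix]] := sP n x Lx.
have [m im] : exists m, nth i0 (s n) m = i.
  elim: (s n) si => //= z t IH [->|/IH[m <-]]; first by exists 0%N.
  by exists m.+1.
by exists (pickle (n, m)); rewrite pickleK im (dist_sym dM); exact: lt_trans ix ne.
Qed.

(** Let [r x] be the supremum of the radii of compact balls at [x]. A maximal set [S] separated at
    scale [r / 4] is closed discrete because [r] is 1-Lipschitz. Compact, hence separable, balls
    around its points cover [M], so [S] has size at least [K]. *)
Lemma locally_compact_closed_discrete K : has_weight M K ->
  ~ countable [set: K] -> locally_compact [set: M] ->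
  exists S : K -> M, forall L, compact L -> finite_set [set a | L (S a)].
Proof.
move=> MK Kunc lc.
(* The cap 1 keeps the supremum finite. *)
pose A x := [set e : R | 0 < e <= 1 /\ compact [set y | d x y <= e]].
have cball x (e : R) (U : set M) : compact U -> [set y | d x y <= e] `<=` U ->
    compact [set y | d x y <= e].
  exact: (subclosed_compact (@closed_dist_le _ _ _ dM x e)).
have Asup x : has_sup (A x).
  split; last by exists 1 => e [/andP[]].
  have [U xU [Uc Ucl]] := lc x I.
  have /(nbhs_distP dM)[e e0 eU] : nbhs x U.
    by have : nbhs x [set y | setT y -> U y] := xU; apply: filterS => y; exact.
  pose e' := Num.min 1 (e / 2) : R; exists e'; split.
    by rewrite lt_min ltr01 ge_min lexx /= andbT; lra.
  apply: cball Uc _ => y /=.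
  by rewrite le_min => /andP[_ xy]; apply: eU; lra.
pose r x := sup (A x).
have r0 x : 0 < r x.
  have [[e Ae] _] := Asup x.
  by apply: lt_le_trans (ub_le_sup (Asup x).2 Ae); case: Ae => /andP[].
have Asub x e e' : A x e -> 0 < e' -> e' <= e -> A x e'.
  move=> [/andP[e0 e1] ec] e'0 e'e; split; first by lra.
  by apply: (cball _ _ _ ec) => y /=; lra.
have rlip x y : r x <= r y + d x y.
  apply: ge_sup => [|e [/andP[e0 e1] ec]]; first by have [] := Asup x.
  have [ed|de] := leP e (d x y); first by have := r0 y; lra.
  rewrite -lerBlDr; apply: (ub_le_sup (Asup y).2); split.
    by have := dist_ge0 dM x y; lra.
  apply: (cball _ _ _ ec) => z /= yz.
  by have := dist_tri dM y x z; lra.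
have rcpt x : compact [set y | d x y <= r x / 2].
  have [|e Ae re] := @sup_adherent _ (A x) (r x / 2) _ (Asup x).
    by have := r0 x; lra.
  have [] // : A x (r x / 2).
  by apply: Asub Ae _ _; have := r0 x; move: re; rewrite -/(r x); lra.
(* With the factor 1/4, a point [y] within [r x / 4] or [r y / 4] of [x] is within [r x / 2] of [x]
   by the Lipschitz bound, where the ball is compact. *)
have [|S [Ssep Smax]] := @exists_maximal_separated (fun x => r x / 4).
  by move=> x; have := r0 x; lra.
have Sdisc L : compact L -> finite_set [set x | L x /\ S x].
  move=> Lc; apply: contrapT => /infinite_set_seq[u uI uLS].
  have [N|x Lx xP] := compact_cluster_seq dM (u := u) Lc.
    by exists N => //; have [] := uLS N.
  (* Two points of [S] this close to [x] are less than [r x / 8] apart, while the Lipschitz bound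
     separates them by more than [15/64] of [r x]. *)
  have e0 : 0 < r x / 16 by have := r0 x; lra.
  have [i [_ _ xi]] := xP _ e0 0%N; have [j [ij _ xj]] := xP _ e0 i.+1.
  have uij : u i <> u j by move=> /uI ijE; rewrite ijE ltnn in ij.
  have [+ _] := Ssep _ _ (uLS i).2 (uLS j).2 uij.
  have := rlip x (u i); have := dist_tri dM x (u i) (u j).
  by have := r0 x; rewrite (dist_sym dM (u i) x); lra.
have [x0 _] := uncountable_weight_nonempty MK Kunc.
have /choice[D DP] x := compact_countable_approximation x0 (rcpt x)
  (fun y e _ e0 => ex_intro (fun z => d y z < e) y
     (eq_ind_r (fun t => t < e) e0 (distxx dM y))).
pose J := ({x | S x} * nat)%type.
have KJ : type_card_le K (J * nat).
  apply: (@dense_weight_le J (fun p => D (sval p.1) p.2)) => // y e e0.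
  have [x Sx xy] := Smax y.
  have [|p yp] := DP x y e _ e0.
    by case: xy => /=; have := rlip y x; have := r0 x; rewrite (dist_sym dM y x); lra.
  by exists (exist _ x Sx, p).
have nn : type_card_le (nat * nat) nat.
  by have /card_eqPle[] := card_nat2.
have Sinf : infinite_set [set: {x | S x}].
  move=> /finite_set_countable Sfin; apply: Kunc.
  apply: (type_card_le_trans KJ); apply: type_card_le_trans (nn).
  apply: type_card_le_prod (type_card_le_refl _).
  apply: type_card_le_trans (nn).
  exact: type_card_le_prod (type_card_le_refl _).
have Snat := (nat_card_le_infinite _).1 Sinf.
have /type_card_leP[i iI] : type_card_le K {x | S x}.
  apply: (type_card_le_trans KJ).
  have SS := infinite_card_square Sinf.
  apply: type_card_le_trans (SS); apply: type_card_le_prod => //.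
  apply: type_card_le_trans (SS); apply: type_card_le_prod => //.
  exact: type_card_le_refl.
exists (fun a => sval (i a)) => L /Sdisc Lfin.
have : finite_set ((fun a => sval (i a)) @^-1` [set x | L x /\ S x]).
  by apply: finite_preimage => // x y _ _ /sval_inj/iI.
by apply: sub_finite_set => a La; split=> //; exact: svalP (i a).
Qed.

(** The basic sets with compact closure cover [M], so finitely many of them cover a compact set. [C]
    is empty on the other basic sets, so that every finite set of indices yields a compact union. *)
Lemma locally_compact_finite_rel K : has_weight M K -> locally_compact [set: M] ->
  tukey_conn (finite_rel K) (compact_rel M).
Proof.
move=> [[B [Bo Bb] /card_eqPle[/set_card_leP[f fI] _]] _] lc.
pose C (u : {U | B U}) :=
  if pselect (compact (closure (sval u))) then closure (sval u) else set0.
have Cc u : compact (C u) by rewrite /C; case: pselect => //= _; exact: compact0.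
have /choice[psi psiP] (L : set M) : exists F : finite_subsets K, compact L ->
    forall x, L x -> exists u, val F (f u) /\ C u x.
  have [Lc|nL] := pselect (compact L); last first.
    by exists (Sub set0 (mem_set (finite_set0 K)) : finite_subsets K).
  have [x Lx|s sL] := compact_finite_subcover (C := C) Lc.
    have [U xU [Uc Ucl]] := lc x I.
    have [|V [BV Vx] VU] := Bb x U.
      by have : nbhs x [set y | setT y -> U y] := xU; apply: filterS => y; exact.
    exists (exist _ V BV); rewrite /C; case: pselect => [_|[]] /=.
      apply: filterS (@subset_closure _ V) _.
      by apply: open_nbhs_nbhs; split=> //; exact: Bo.
    apply: subclosed_compact Uc _; first exact: closed_closure.
    by rewrite closureE => y; apply.
  have Ffin : finite_set (f @` [set u | List.In u s]).
    by apply: finite_image; exact: seq_finite_set.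
  exists (Sub (f @` [set u | List.In u s]) (mem_set Ffin) : finite_subsets K).
  by move=> _ x /sL[u [us ux]]; exists u; split=> //; exists u.
apply: (@tukey_conn_to_family _ _ _ _ _ psi
  (fun F => \bigcup_(u in f @^-1` (val F)) C u)).
  move=> F; apply: bigcup_finite_compact => [|//]; apply: finite_preimage.
    by move=> x y _ _; exact: fI.
  exact: finite_setP_family.
move=> L F Lc /family_leP LF x /(psiP L Lc)[u [/LF Fu Cu]].
by exists u.
Qed.

End MetricTukey.

(** The values of [phi] form a dominating family, and there are only [K] many finite subsets. *)
Lemma finite_rel_dominated_card_le D K : is_dominating_number D ->
  infinite_set [set: K] -> tukey_conn (finite_rel K) dominated ->
  type_card_le D K.
Proof.
move=> [_ Dmin] Kinf [psi [phi h]].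
apply: type_card_le_trans (infinite_card_finite_subsets Kinf).
apply: (@card_le_trans _ _ _ (range phi)); last exact: card_image_le.
apply: Dmin => f; exists (phi (psi f)); first by exists (psi f).
by apply/asboolP => n; apply: h.
Qed.

(** A function is sent to the index of a dominating function above it, and a finite set of indices
    to the pointwise maximum of their functions. *)
Lemma dominating_finite_rel D K : is_dominating_number D -> type_card_le D K ->
  tukey_conn (finite_rel K) dominated.
Proof.
move=> [[A Acof /card_eqPle[AD _]] _] DK.
have /set_card_leP[j jI] : A #<= [set: K] := card_le_trans AD DK.
have /choice[c cP] (f : nat -> nat) : exists a : {g | A g}, dominated f (sval a).
  by have [g Ag /asboolP fg] := Acof f; exists (exist _ g Ag).
have /choice[phi phiP] (G : set K) : exists g : nat -> nat, finite_set G ->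
    forall a, G (j a) -> dominated (sval a) g.
  have [/finite_set_seq[s sG]|nG] := pselect (finite_set G); last by exists (fun=> 0%N).
  suff [g gP] : exists g, forall a, List.In (j a) s -> dominated (sval a) g.
    by exists g => _ a /sG; exact: gP.
  elim: s {sG} => [|k s [g gP]]; first by exists (fun=> 0%N).
  have [[a ak]|na] := pselect (exists a, j a = k); last first.
    by exists g => b /= [kb|]; [case: na; exists b|exact: gP].
  exists (fun n => maxn (sval a n) (g n)) => b /= [kb|/gP bg] n.
    by rewrite -ak in kb; rewrite (jI _ _ kb) leq_maxl.
  by rewrite leq_max bg orbT.
apply: (@tukey_conn_from_family _ _ _ _ _ (fun f => [set j (c f)]) phi).
  by move=> f; exact: finite_set1.
move=> f G Gfin fG n; apply: leq_trans (cP f n) _.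
by apply: phiP => //; exact: fG.
Qed.

(** * Compact subsets of countable spaces *)

(** [O] is omega_1, the shortest uncountable segment of a well-order of [K]. [code a] witnesses that
    the segment below [a] is countable; countably many such segments cannot exhaust [O], so
    sequences are bounded. *)
Lemma exists_omega1 K : ~ countable [set: K] ->
  exists (O : Type) (o0 : O) (lt : O -> O -> Prop) (code : O -> O -> nat),
    [/\ type_card_le O K, well_founded lt,
        forall a b c, lt b a -> lt c a -> code a b = code a c -> b = c &
        forall s : nat -> O, exists a, forall n, lt (s n) a].
Proof.
move=> Kunc.
have [lt [B [[wf tr tot] Bunc Bseg]]] :=
  @minimal_initial_segment K (fun A => ~ countable A) Kunc.
pose O := {x | B x}.
have segE (a : O) : exists code : K -> nat, forall b c,
    lt b (sval a) -> lt c (sval a) -> code b = code c -> b = c.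
  have /contrapT/set_card_leP[f fI] := Bseg _ (svalP a).
  exists (fun b => if pselect (lt b (sval a)) is left h then f (exist _ b h) else 0%N).
  move=> b c ba ca; do 2 case: pselect => // ?.
  by move=> /fI[].
have /choice[code codeP] := segE.
have [x0 Bx0] : B !=set0.
  by apply/set0P/eqP => B0; apply: Bunc; rewrite B0; exact: countable0.
exists O, (exist _ x0 Bx0), (fun a b => lt (sval a) (sval b)), (fun a b => code a (sval b)); split.
- exact: sig_card_le.
- move=> x; move: {2}(sval x) (erefl (sval x)) => y.
  elim/(well_founded_ind wf): y x => y IH x xy; split=> z; rewrite xy => zy.
  exact: IH zy _ erefl.
- move=> a [b Bb] [c Bc] /= ba ca /(codeP _ _ _ ba ca) bc; exact: eq_exist.
- move=> s; apply: contrapT => /forallNP nob; apply: Bunc.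
  apply: (@sub_countable _ _ _ (\bigcup_n ([set b | lt b (sval (s n))] `|` [set sval (s n)]))).
    apply: subset_card_le => x Bx.
    have /existsNP[n nx] := nob (exist _ x Bx).
    exists n => //; have [|?|?] := tot (sval (s n)) x; first by move/nx.
    + by right.
    + by left.
  apply: bigcup_countable => // n _.
  rewrite -bigcup2E; apply: bigcup_countable => // -[_|[_|k _]] /=.
  - by apply: contrapT; apply: Bseg; exact: svalP (s n).
  - exact: countable1.
  - exact: countable0.
Qed.

Section CountableSpace.
Context {R : realType} {T : topologicalType} {d : T -> T -> R}.
Hypothesis dT : compatible_metric d.
Context {O : Type} {lt : O -> O -> Prop} {code : O -> O -> nat}.
Hypothesis lt_wf : well_founded lt.
Hypothesis code_inj : forall a b c, lt b a -> lt c a -> code a b = code a c -> b = c.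
Hypothesis lt_bounded : forall s : nat -> O, exists a, forall n, lt (s n) a.
Variables (o0 : O) (q : nat -> T).
Hypothesis q_surj : forall x, exists i, q i = x.

(** Closed shells covering everything but the centre; the shell [n = 0] has no outer radius. *)
Definition annulus x n : set T := [set y |
  n.+1%:R^-1 <= d x y /\ ((0 < n)%N -> d x y <= n%:R^-1)].

(** [f] packs the number [f 0] and an array with rows [slice f n]. In a scale, [f 0] bounds the
    index of the centre, the head of row [n] bounds the code of the rank used in annulus [n], and
    the tail of the row governs the set placed there. *)
Definition slice (f : nat -> nat) (n m : nat) := f (pickle (n, m)).+1.

(* [countable_scale a f] has Cantor-Bendixson rank at most [a]: it consists of
   finitely many points together with, around each of them, a sequence of sets
   of smaller rank in shrinking annuli. *)
Inductive countable_scale : O -> (nat -> nat) -> set T :=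
| countable_scale_point a f i : (i <= f 0)%N -> countable_scale a f (q i)
| countable_scale_annulus a b f i n x : (i <= f 0)%N -> lt b a ->
    (code a b <= slice f n 0)%N -> annulus (q i) n x ->
    countable_scale b (slice f n \o succn) x -> countable_scale a f x.

Lemma countable_scale_inv a f x : countable_scale a f x ->
  exists2 i, (i <= f 0)%N & x = q i \/ exists n b, [/\ lt b a,
    (code a b <= slice f n 0)%N, annulus (q i) n x &
    countable_scale b (slice f n \o succn) x].
Proof.
case=> {a f x} [a f i if0|a b f i n x if0 ba abf ix bx]; first by exists i; [|left].
by exists i => //; right; exists n, b.
Qed.

Lemma countable_scale_monotone a f g : dominated f g ->
  countable_scale a f `<=` countable_scale a g.
Proof.
move=> fg x ax; elim: ax g fg => {a f x} [a f i if0|a b f i n x if0 ba abf ix _ IH] g fg.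
  by apply: countable_scale_point; apply: leq_trans if0 _.
apply: (countable_scale_annulus _ ba _ ix); first exact: leq_trans if0 _.
  exact: leq_trans abf (fg _).
by apply: IH => m; exact: fg.
Qed.

Lemma closed_annulus x n : closed (annulus x n).
Proof.
rewrite (_ : annulus x n = [set y | n.+1%:R^-1 <= d x y] `&`
    (if (0 < n)%N then [set y | d x y <= n%:R^-1] else setT)).
  apply: closedI; first exact: (@closed_dist_ge _ _ _ dT).
  by case: ifP => _; [exact: (@closed_dist_le _ _ _ dT)|exact: closedT].
by apply/seteqP; split=> y [nx xy]; split=> //; move: xy; case: ifP => // _; exact.
Qed.

Lemma annulus_cover x y : x <> y -> exists n, annulus x n y.
Proof.
move=> /(dist_gt0 dT) xy0; have [n nxy] := invSn_lt xy0.
have ex : exists n, n.+1%:R^-1 <= d x y by exists n; exact: ltW.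
case: (ex_minnP ex) => m mxy mmin; exists m; split=> // m0.
rewrite leNgt; apply/negP => xym.
have := mmin m.-1; rewrite prednK // => /(_ (ltW xym)).
by rewrite leqNgt ltn_predL m0.
Qed.

(** By induction on the rank. In each annulus only finitely many ranks [b] have a code within the
    bound, and the annuli shrink to the centre [q i], so [compact_converging] applies. *)
Lemma countable_scale_compact a f : compact (countable_scale a f).
Proof.
elim/(well_founded_ind lt_wf): a f => a IH f.
pose C i n := (\bigcup_(b in [set b | lt b a /\ (code a b <= slice f n 0)%N])
  countable_scale b (slice f n \o succn)) `&` annulus (q i) n.
have -> : countable_scale a f = \bigcup_(i in [set i | (i <= f 0)%N])
    ([set q i] `|` \bigcup_n C i n).
  apply/seteqP; split=> x.
    move=> /countable_scale_inv[i if0 [->|[n [b [ba abf ix bx]]]]].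
      by exists i => //; left.
    by exists i => //; right; exists n => //; split=> //; exists b.
  move=> [i if0 [->|[n _ [[b [ba abf] bx] ix]]]].
    exact: countable_scale_point.
  exact: (countable_scale_annulus if0 ba abf ix bx).
apply: bigcup_finite_compact => [|i _].
  by apply: (@sub_finite_set _ _ `I_(f 0).+1) => // i /=; rewrite ltnS.
apply: compact_converging => [n|U /(nbhs_distP dT)[e e0 eU]].
  apply: compact_closedI; last exact: closed_annulus.
  apply: bigcup_finite_compact => [|b [ba _]]; last exact: IH.
  apply: contrapT => /infinite_set_seq[u uI uP].
  have : finite_set ((code a \o u) @^-1` [set k | (k <= slice f n 0)%N]).
    apply: finite_preimage.
      move=> k l _ _ /= kl; apply: uI.
      exact: code_inj (uP k).1 (uP l).1 kl.
    by apply: (@sub_finite_set _ _ `I_(slice f n 0).+1) => // k /=; rewrite ltnS.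
  apply: (@sub_infinite_set _ setT); last exact: infinite_nat.
  by move=> k _; have [] := uP k.
(* Annulus [n] has outer radius [1/n], hence the shift to [N.+1]. *)
have [N Ne] := invSn_lt e0; exists N.+1 => n Nn x [_ [_ xn]]; apply: eU.
apply: le_lt_trans (xn _) _; first exact: leq_trans Nn.
by apply: le_lt_trans Ne; rewrite lef_pV2 ?posrE ?ler_nat ?ltr0n //; exact: leq_trans Nn.
Qed.

(** If no scale contains [L], decreasing closed pieces [X n] that no scale contains are chosen,
    [X n.+1] lying in an annulus around [q n]. By compactness they have a common point; it is some
    [q n], which no annulus around [q n] contains. *)
Lemma compact_sub_countable_scale L : compact L ->
  exists a f, L `<=` countable_scale a f.
Proof.
pose cov (X : set T) := exists a f, X `<=` countable_scale a f.
(* Coverings of the pieces in all annuli around [q i] assemble into one: the rank is above all the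
   [a n], and [g] packs [i], the codes of the [a n] and the functions [f n]. *)
have covP X i : (forall n, cov (X `&` annulus (q i) n)) -> cov X.
  move=> Xn.
  have /choice[a aP] := Xn; have /choice[f fP] := aP.
  have [b ab] := lt_bounded a.
  pose g k := if k is k'.+1 then
      if unpickle k' is Some (n, m) then
        if m is m'.+1 then f n m' else code b (a n)
      else 0%N else i.
  exists b, g => x Xx; have [->|xi] := pselect (x = q i).
    exact: countable_scale_point.
  have [|n ix] := @annulus_cover (q i) x; first by move=> /esym.
  apply: (@countable_scale_annulus _ (a n) _ i n) => //.
    by rewrite /slice /g pickleK.
  have -> : slice g n \o succn = f n.
    by apply/funext => m; rewrite /slice /g /= pickleK.
  exact: fP.
move=> Lc; apply: contrapT => Lcov.
have /choice[g gP] (p : nat * set T) : exists Y, ~ cov p.2 ->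
    ~ cov Y /\ exists n, Y = p.2 `&` annulus (q p.1) n.
  have [pc|npc] := pselect (cov p.2); first by exists set0.
  have /existsNP[n ncov] : ~ forall n, cov (p.2 `&` annulus (q p.1) n).
    by move=> /covP.
  by exists (p.2 `&` annulus (q p.1) n) => _; split=> //; exists n.
pose X := fix X n := if n is m.+1 then g (m, X m) else L.
have Xcov n : ~ cov (X n) by elim: n => //= n IH; have [] := gP (n, X n) IH.
have Xann n : exists m, X n.+1 = X n `&` annulus (q n) m.
  by have [] := gP (n, X n) (Xcov n).
have XS m n : (m <= n)%N -> X n `<=` X m.
  elim: n => [|n IH]; first by rewrite leqn0 => /eqP ->.
  rewrite leq_eqVlt => /orP[/eqP -> //|/IH XS].
  by apply: subset_trans XS; have [k ->] := Xann n; exact: subIsetl.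
have Xcl n : closed (X n).
  elim: n => [|n IH]; first exact: (compact_metric_closed dT).
  by have [k ->] := Xann n; apply: closedI => //; exact: closed_annulus.
have /choice[u uX] n : exists x, X n x.
  apply: contrapT => /forallNP X0; apply: (Xcov n).
  have [a _] := lt_bounded (fun=> o0).
  by exists a, (fun=> 0%N) => x /X0.
have [N|x Lx xP] := compact_cluster_seq dT (u := u) Lc.
  by exists N => //; apply: (XS 0%N N) => //.
have xX n : X n x.
  rewrite [X n](closure_id _).1 // => U /(nbhs_distP dT)[e e0 eU].
  have [k [nk _ xk]] := xP e e0 n; exists (u k); split; last exact: eU.
  exact: XS nk _ (uX k).
have [n nx] := q_surj x; have := xX n.+1.
have [k ->] := Xann n; rewrite -nx => -[_ [+ _]].
by rewrite (distxx dT) leNgt invSn_gt0.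
Qed.

Lemma countable_space_baire_covers : baire_covers countable_scale.
Proof.
split; [exact: countable_scale_compact|exact: countable_scale_monotone|].
move=> L /compact_sub_countable_scale[a [f Lf]]; exists [set a], f.
by split; [exact: finite_set1|move=> x /Lf ?; exists a].
Qed.

End CountableSpace.

(** * Products with the rationals *)

Lemma compact_image (T U : topologicalType) (f : T -> U) L :
  continuous f -> compact L -> compact (f @` L).
Proof.
by move=> fc; apply: continuous_compact; exact: continuous_subspaceT.
Qed.

Lemma compact_fst (M N : topologicalType) (L : set (M * N)) :
  compact L -> compact (fst @` L).
Proof. by apply: compact_image => x; exact: cvg_fst. Qed.

Lemma compact_snd (M N : topologicalType) (L : set (M * N)) :
  compact L -> compact (snd @` L).
Proof. by apply: compact_image => x; exact: cvg_snd. Qed.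

(** A compact set lies in the product of its projections, which are compact. *)
Lemma compact_prod_conn (M N : topologicalType) :
  tukey_conn (tukey_prod (compact_rel M) (compact_rel N))
    (compact_rel (M * N)%type).
Proof.
have /choice[psi psiP] (L : set (M * N)) : exists p : compacts M * compacts N,
    compact L -> L `<=` val p.1 `*` val p.2.
  have [Lc|nL] := pselect (compact L); last first.
    by exists (Sub set0 (mem_set (@compact0 M)), Sub set0 (mem_set (@compact0 N))).
  exists (Sub (fst @` L) (mem_set (compact_fst Lc)),
    Sub (snd @` L) (mem_set (compact_snd Lc))) => _ [x y] Lxy.
  by split; exists (x, y).
apply: (@tukey_conn_to_family _ _ _ _ _ psi (fun p => val p.1 `*` val p.2)).
  by move=> p; apply: compact_setX; rewrite -[compact _]/((@compact _ : set _) _) -inE;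
    exact: valP.
move=> L [A B] Lc [/= /family_leP LA /family_leP LB] x /(psiP L Lc)[? ?].
by split; [exact: LA|exact: LB].
Qed.

Lemma compact_prod_fst_conn (M N : topologicalType) (y : N) :
  tukey_conn (compact_rel (M * N)%type) (compact_rel M).
Proof.
have /choice[phi phiP] (L : set (M * N)) : exists A : compacts M,
    compact L -> forall x, L x -> val A x.1.
  have [Lc|nL] := pselect (compact L); last first.
    by exists (Sub set0 (mem_set (@compact0 M))).
  by exists (Sub (fst @` L) (mem_set (compact_fst Lc))) => _ x Lx; exists x.
apply: (@tukey_conn_from_family _ _ _ _ _ (fun A : compacts M => val A `*` [set y]) phi).
  move=> A; apply: compact_setX; last exact: compact_set1.
  by rewrite -[compact _]/((@compact _ : set _) _) -inE; exact: valP.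
move=> A L Lc AL; apply/family_leP => x Ax.
by apply: (phiP L Lc (x, y)); apply: AL.
Qed.

Section MetricRat.
Context {R : realType}.

Definition rat_dist (p q : rat^o) : R := ratr `|p - q|.

Lemma rat_dist_compatible : compatible_metric rat_dist.
Proof.
split; first split.
- move=> p q; rewrite /rat_dist; split=> [|->]; last by rewrite subrr normr0 rmorph0.
  by move/eqP; rewrite fmorph_eq0 normr_eq0 subr_eq0 => /eqP.
- by move=> p q; rewrite /rat_dist distrC.
- move=> q p r; rewrite /rat_dist -rmorphD ler_rat.
  by rewrite (le_trans _ (ler_normD _ _)) // addrA subrK.
move=> q; rewrite -filter_from_ballE; apply/seteqP; split=> U [e /= e0 eU].
  exists (ratr e : R); first by rewrite /= ltr0q.
  by move=> y /=; rewrite /rat_dist ltr_rat => /eU.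
have [r /andP[r0 re]] : exists r : rat, 0 < (ratr r : R) < e.
  have [r] := rat_in_itvoo e0; rewrite in_itv /= => re; exists r; exact: re.
exists r; first by rewrite /= -(ltr0q R).
move=> y; rewrite /ball /= => qy; apply: eU; rewrite /= /rat_dist.
by apply: lt_trans re; rewrite ltr_rat.
Qed.

Lemma rat_enumeration : exists u : nat -> rat, forall q, exists n, u n = q.
Proof.
by exists (fun n => odflt 0 (unpickle n)) => q; exists (pickle q); rewrite pickleK.
Qed.

Lemma uncountable_rat_conn K : ~ countable [set: K] ->
  tukey_conn (tukey_prod (finite_rel K) dominated) (compact_rel rat^o).
Proof.
move=> /exists_omega1[T [t0 [ltT [code [TK wf inj bnd]]]]].
have [u uS] := rat_enumeration.
have := countable_space_baire_covers rat_dist_compatible wf inj bnd t0 (q := u) uS.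
move=> /baire_covers_conn; apply: tukey_conn_trans; apply: tukey_conn_prod.
  exact: finite_rel_card_le.
by exists id, id.
Qed.

Context {M : topologicalType} {d : M -> M -> R}.
Hypothesis dM : compatible_metric d.

Definition prod_rat_dist (p q : (M * rat^o)%type) : R := d p.1 q.1 + rat_dist p.2 q.2.

Lemma prod_rat_dist_compatible : compatible_metric prod_rat_dist.
Proof.
have rM := rat_dist_compatible.
split; first split.
- move=> [x p] [y q]; rewrite /prod_rat_dist /=; split=> [h|[-> ->]]; last first.
    by rewrite (distxx dM) (distxx rM) addr0.
  have [xy0 pq0] : d x y = 0 /\ rat_dist p q = 0.
    move: h (dist_ge0 dM x y) (dist_ge0 rM p q).
    by move: (d x y) (rat_dist p q) => a b ? ? ?; split; lra.
  by rewrite (dist_eq0 dM xy0) (dist_eq0 rM pq0).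
- by move=> [x p] [y q]; rewrite /prod_rat_dist /= (dist_sym dM) (dist_sym rM).
- move=> [y q] [x p] [z r]; rewrite /prod_rat_dist /=.
  have := dist_tri dM y x z; have := dist_tri rM q p r.
  move: (rat_dist p q) (rat_dist q r) (rat_dist p r) => a b c.
  by move: (d x y) (d y z) (d x z) => ? ? ? ? ?; lra.
move=> [x p]; apply/seteqP; split=> U.
  move=> [[A B] /= [/(nbhs_distP dM)[a a0 aA] /(nbhs_distP rM)[b b0 bB]] ABU].
  exists (Num.min a b); first by rewrite /= lt_min a0.
  move=> [y q]; rewrite /= /prod_rat_dist /= lt_min => /andP[h1 h2].
  apply: ABU; split => /=; [apply: aA|apply: bB].
    by move: (dist_ge0 rM p q) h1; move: (rat_dist p q) (d x y) => ? ? ? ?; lra.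
  by move: (dist_ge0 dM x y) h2; move: (rat_dist p q) (d x y) => ? ? ? ?; lra.
move=> [e e0 eU].
exists ([set y | d x y < e / 2], [set q | rat_dist p q < e / 2]).
  have e2 : 0 < e / 2 by move: e0 => /= ?; lra.
  split=> /=.
    by apply/(nbhs_distP dM); exists (e / 2).
  by apply/(nbhs_distP rM); exists (e / 2).
move=> [y q] [/= h1 h2]; apply: eU; rewrite /= /prod_rat_dist /=.
by move: (rat_dist p q) (d x y) h1 h2 => ? ? ? ?; lra.
Qed.

(* Baire's theorem: nested balls avoiding the countably many points of
   [{x} * rat] one after the other. *)
Lemma prod_rat_not_completely_metrizable (x : M) :
  ~ completely_metrizable R (M * rat^o)%type.
Proof.
move=> [D DM Dcomplete].
pose e (q : rat^o) : (M * rat^o)%type := (x, q).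
have rM := rat_dist_compatible.
(* The fibre over [x] is closed, so the limit of the centres will again be some [e q]. *)
have ecl : closed (range e).
  have -> : range e = fst @^-1` [set x].
    apply/seteqP; split=> [_ [q _ <-]//|[y q] /= ->]; by exists q.
  apply: closed_comp; first by move=> ? _; exact: cvg_fst.
  by apply: (compact_metric_closed dM); exact: compact_set1.
have enear q r : 0 < r -> exists2 b, 0 < b & forall p, rat_dist q p < b -> D (e q) (e p) < r.
  move=> r0.
  have : nbhs (e q) [set y | D (e q) y < r] by apply/(nbhs_distP DM); exists r.
  move=> /(nbhs_distP prod_rat_dist_compatible)[b b0 bD].
  by exists b => // p qp; apply: bD; rewrite /prod_rat_dist /= (distxx dM) add0r.
have [enum enumS] := rat_enumeration.
(* a state is a center and a radius *)
pose S := (rat^o * R)%type.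
(* The next ball lies inside the given one, has radius at most [1/(n+1)] and omits [enum n]; its
   centre can be chosen different from [enum n] because no rational is isolated. *)
have /choice[g gP] (t : nat * S) : exists s : S, 0 < t.2.2 ->
    [/\ 0 < s.2, s.2 <= t.1.+1%:R^-1,
     D (e t.2.1) (e s.1) + s.2 <= t.2.2 & s.2 < D (e (enum t.1)) (e s.1)].
  case: t => n [q r] /=; have [r0|] := pselect (0 < r); last by exists (0, 0).
  have [b b0 bD] := enear q (r / 2) (divr_gt0 r0 (ltr0Sn _ _)).
  have [p pn qp] : exists2 p, p <> enum n & rat_dist q p < b.
    have [s /andP[s0 sb]] : exists s : rat, 0 < (ratr s : R) < b.
      have [s] := rat_in_itvoo b0; rewrite in_itv /= => sb; exists s; exact: sb.
    have [qn|qn] := pselect (q = enum n); last by exists q; rewrite ?(distxx rM).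
    exists (q + s); rewrite -?qn.
      move=> qs; have sE : s = 0 by apply: (@addrI rat q); rewrite addr0.
      by rewrite sE rmorph0 ltxx in s0.
    rewrite /rat_dist opprD addrA subrr add0r normrN gtr0_norm //.
    by rewrite -(ltr0q R).
  have np : 0 < D (e (enum n)) (e p).
    by apply: (dist_gt0 DM) => -[] /esym.
  have qpr := bD _ qp.
  pose m := Num.min (r / 2) (Num.min n.+1%:R^-1 (D (e (enum n)) (e p) / 2)).
  have [m1 m2 m3] : [/\ m <= r / 2, m <= n.+1%:R^-1 & m <= D (e (enum n)) (e p) / 2].
    by rewrite /m !ge_min !lexx !orbT.
  have m0 : 0 < m by rewrite /m !lt_min invSn_gt0 andTb; apply/andP; split; lra.
  by exists (p, m) => _; split=> //=; lra.
pose s := fix s n := if n is m.+1 then g (m, s m) else (0 : rat^o, 1 : R).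
have s0 n : 0 < (s n).2.
  by elim: n => [|n IH] //=; have [] := gP (n, s n) IH.
have sP n := gP (n, s n) (s0 n).
have snest m n : (m <= n)%N -> D (e (s m).1) (e (s n).1) + (s n).2 <= (s m).2.
  elim: n => [|n IH]; first by rewrite leqn0 => /eqP ->; rewrite (distxx DM) add0r.
  rewrite leq_eqVlt => /orP[/eqP ->|/IH]; first by rewrite (distxx DM) add0r.
  have [_ _ + _] := sP n; rewrite -/(s n.+1) /=.
  by have := dist_tri DM (e (s n).1) (e (s m).1) (e (s n.+1).1); lra.
have [|z uz] := Dcomplete (fun n => e (s n).1).
  move=> a a0; have a2 : 0 < a / 2 by lra.
  have [N Na] := invSn_lt a2; exists N.+1 => m n /snest Nm /snest Nn.
  have [_ sN _ _] := sP N; rewrite -/(s N.+1) /= in sN.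
  have := dist_tri DM (e (s N.+1).1) (e (s m).1) (e (s n).1).
  rewrite (dist_sym DM (e (s m).1) (e (s N.+1).1)).
  have := s0 m; have := s0 n.
  by move: (N.+1%:R^-1) Na sN => rr ? ? ? ? ?; lra.
have [q _ qz] : range e z.
  by apply: (closed_cvg (range e)) uz => //; apply: nearW => n; exists (s n).1.
have [n nq] := enumS q.
have [_ _ _] := sP n; rewrite -/(s n.+1) /= nq.
(* In the limit, [e q] lies in the closed ball of stage [n + 1], which was chosen to omit
   [enum n]. *)
apply/negP; rewrite -leNgt.
apply/ler_addgt0Pr => a a0.
have [N NP] := (cvg_distP DM _ _).1 uz a a0.
have := NP (maxn N n.+1) (leq_maxl _ _); have := snest _ _ (leq_maxr N n.+1).
have := s0 (maxn N n.+1); rewrite qz.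
set w := e (s n.+1).1; set v := e (s (maxn N n.+1)).1 => k0 k1 k2.
have := dist_tri DM v z w; rewrite (dist_sym DM v w).
move: (D z w) (D z v) (D w v) k0 k1 k2 => zw zv wv.
by move: (s (maxn N n.+1)).2 (s n.+1).2 => ? ? ? ? ? ?; lra.
Qed.

End MetricRat.

(** * Complete metric spaces and cardinals below aleph_omega *)

Section CompleteMetric.
Context {R : realType} {M : topologicalType} {d : M -> M -> R}.
Hypothesis dM : compatible_metric d.
Hypothesis dcomplete : forall u : nat -> M, cauchy_seq d u -> exists x : M, u @ \oo --> x.

(** [f n] prescribes how many terms of [c j] serve as a net at scale [1/(n+1)]; closed balls make
    the resulting totally bounded set closed. *)
Definition totally_bounded_scale J (c : J -> nat -> M) (j : J) (f : nat -> nat) :=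
  \bigcap_n \bigcup_(i in [set i | (i <= f n)%N]) [set x | d (c j i) x <= n.+1%:R^-1].

(** Completeness makes the scales compact. Conversely, [f n] comes from a finite subcover of [L] by
    balls around the terms of a sequence approximating [L]. *)
Lemma complete_baire_covers J (c : J -> nat -> M) :
  (forall L, compact L -> exists j, forall x (e : R), L x -> 0 < e ->
     exists n, d x (c j n) < e) ->
  baire_covers (totally_bounded_scale c).
Proof.
have leI (m : nat) : finite_set [set i | (i <= m)%N].
  by apply: (@sub_finite_set _ _ `I_m.+1) => // i /=; rewrite ltnS.
move=> cP; split.
- move=> j f; apply: (complete_totally_bounded_compact dM).
    move=> e e0; have [N Ne] := invSn_lt e0.
    have [s sP] := finite_set_seq (finite_image (c j) (leI (f N))).
    exists s => x /(_ N I)[i iN ix].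
    by exists (c j i); [apply/sP; exists i|exact: le_lt_trans ix Ne].
  move=> u /dcomplete[x ux] uC; exists x => //.
  apply: (closed_cvg (totally_bounded_scale c j f)) ux; last exact: nearW.
  apply: closed_bigI => n _.
  apply: bigcup_finite_ind => //; first exact: closed0.
    by move=> A B; exact: closedU.
  by move=> i _; exact: (@closed_dist_le _ _ _ dM).
- move=> j f g fg x fx n _; have [i ifn ix] := fx n I.
  by exists i => //=; exact: leq_trans ifn (fg n).
- move=> L Lc; have [j jP] := cP L Lc.
  have /choice[f fP] (n : nat) : exists N, forall x, L x ->
      exists2 i, (i <= N)%N & d (c j i) x <= n.+1%:R^-1.
    have [x Lx|s sP] := compact_finite_subcover
        (C := fun i => [set y | d (c j i) y < n.+1%:R^-1]) Lc.
      have [i xi] := jP x _ Lx (@invSn_gt0 R n); exists i.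
      apply: open_nbhs_nbhs; split; first exact: (open_dist_ball dM).
      by rewrite /= (dist_sym dM).
    have [N NP] := nat_bounded_finite (seq_finite_set s).
    by exists N => x /sP[i [/NP iN /ltW ix]]; exists i.
  exists [set j], f; split; first exact: finite_set1.
  move=> x Lx; exists j => // n _; have [i ifn ix] := fP n x Lx.
  by exists i.
Qed.

Lemma has_weight_dense K : has_weight M K -> [set: M] !=set0 ->
  exists D : K -> M, forall x (e : R), 0 < e -> exists k, d x (D k) < e.
Proof.
move=> [[B [Bo Bb] /card_eqPle[/set_card_leP[f fI] _]] _] [x0 _].
have /choice[D DP] (k : K) : exists x, forall U : {U | B U}, f U = k ->
    sval U !=set0 -> sval U x.
  have [[U [Uk [x Ux]]]|no] := pselect (exists U : {U | B U}, f U = k /\ sval U !=set0).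
    by exists x => V; rewrite -Uk => /fI ->.
  by exists x0 => U Uk U0; case: no; exists U.
exists D => x e e0; have [|U [BU Ux] Ue] := Bb x [set y | d x y < e].
  by apply/(nbhs_distP dM); exists e.
exists (f (exist _ U BU)); apply: Ue.
by apply: (DP _ (exist _ U BU)) => //; exists x.
Qed.

Lemma complete_aleph_conn n K : has_weight M K -> ~ countable [set: K] ->
  is_aleph n K ->
  tukey_conn (tukey_prod (finite_rel K) dominated) (compact_rel M).
Proof.
move=> MK Kunc nK; have M0 := uncountable_weight_nonempty MK Kunc.
have [D Dd] := has_weight_dense MK M0.
have [k0 _] := infinite_setN0 (is_aleph_infinite nK).
have [c cP] := is_aleph_countable_cofinal nK.
apply: (baire_covers_conn (complete_baire_covers (c := fun k i => D (c k i)) _)).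
move=> L Lc.
have [|s sP] := compact_countable_approximation dM (D := D) k0 Lc.
  by move=> x e _; exact: Dd.
have [k kP] := cP s; exists k => x e Lx e0.
have [m xm] := sP x e Lx e0; have [i im] := kP m.
by exists i; rewrite im.
Qed.

End CompleteMetric.

(** The values at 0, 1, 2, ... are fixed in turn, each time keeping an uncountable set [S n], and
    [v n] is picked in [S n]. At [m] all [f (v n)] with [n > m] agree, so only finitely many values
    have to be bounded. *)
Lemma uncountable_dominated_subset V (f : V -> nat -> nat) : ~ countable [set: V] ->
  exists (v : nat -> V) (g : nat -> nat), injective v /\
    forall n, dominated (f (v n)) g.
Proof.
move=> Vunc.
have /choice[k kP] (t : nat * set V) : exists k, ~ countable t.2 ->
    ~ countable (t.2 `&` [set v | f v t.1 = k]).
  have [ct|nct] := pselect (countable t.2); first by exists 0%N.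
  suff /existsNP[k kP] : ~ forall k, countable (t.2 `&` [set v | f v t.1 = k]).
    by exists k => _.
  move=> h; apply: nct; apply: (@sub_countable _ _ _
    (\bigcup_k (t.2 `&` [set v | f v t.1 = k]))); last exact: bigcup_countable.
  by apply: subset_card_le => v tv; exists (f v t.1).
pose S := fix S n := if n is m.+1 then
  S m `&` [set v | f v m = k (m, S m)] else [set: V].
have Sunc n : ~ countable (S n) by elim: n => //= n; exact: (kP (n, S n)).
have SS m n : (m <= n)%N -> S n `<=` S m.
  elim: n => [|n IH]; first by rewrite leqn0 => /eqP ->.
  rewrite leq_eqVlt => /orP[/eqP -> //|/IH]; apply: subset_trans.
  exact: subIsetl.
have /choice[h hP] (t : nat * seq V) : exists v, S t.1 v /\ ~ List.In v t.2.
  apply: contrapT => no; apply: (Sunc t.1); apply: finite_set_countable.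
  apply: sub_finite_set (seq_finite_set t.2) => v Sv.
  by apply: contrapT => tv; apply: no; exists v.
pose l := fix l n := if n is m.+1 then h (m, l m) :: l m else [::].
pose v n := h (n, l n).
have vl i j : (i < j)%N -> List.In (v i) (l j).
  elim: j => // j IH; rewrite ltnS leq_eqVlt => /orP[/eqP ->|/IH]; first by left.
  by right.
have vne i j : (i < j)%N -> v i <> v j.
  by move=> /vl ij E; have [_] := hP (j, l j); rewrite -/(v j) -E.
exists v, (fun m => maxn (k (m, S m)) (\max_(i < m.+1) f (v i) m)); split.
  move=> i j ijE; have [/vne//|ji|//] := ltngtP i j.
  by case: (vne _ _ ji).
move=> n m; have [nm|mn] := leqP n m.
  by rewrite leq_max (leq_bigmax (Ordinal (nm : (n < m.+1)%N))) orbT.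
have [Svn _] := hP (n, l n); have := SS _ _ mn _ Svn.
by rewrite /= -/(v n) => -[_ ->]; rewrite leq_maxl.
Qed.

Definition covers_seq W (x : nat -> W) (F : nat -> finite_subsets W) :=
  forall n, val (F n) (x n).

Lemma sigT_nat_card_le (P : set nat) (F : nat -> Type) L : infinite_set [set: L] ->
  (forall n, P n -> type_card_le (F n) L) ->
  type_card_le {p : {n & F n} | P (projT1 p)} L.
Proof.
move=> Linf PF; apply: type_card_le_trans (infinite_card_prod_nat Linf).
have FE n : exists i : F n -> L, P n -> injective i.
  have [/PF/type_card_leP[i iI]|nP] := pselect (P n); first by exists i.
  have [l _] := infinite_setN0 Linf.
  by exists (fun=> l).
pose i n := projT1 (cid (FE n)); have iP n : P n -> injective (i n) := projT2 (cid (FE n)).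
apply/type_card_leP; exists (fun p => (projT1 (sval p), i _ (projT2 (sval p)))).
move=> [[n x] /= Pn] [[m y] /= Pm] /= [nm]; subst m => /(iP _ Pn) xy.
by apply: eq_exist; rewrite xy.
Qed.

Lemma aleph_omega_card_le_sigT (A : nat -> Type) W :
  (forall n, is_aleph n (A n)) -> is_aleph_omega W -> type_card_le W {n & A n}.
Proof.
move=> hA [_ hW]; apply: hW => n K nK.
apply: (type_card_le_trans (is_aleph_card_le nK (hA n))).
by apply/type_card_leP; exists (existT A n) => x y; exact: existT_inj2.
Qed.

Lemma aleph_omega_infinite W : is_aleph_omega W -> infinite_set [set: W].
Proof. by move=> [hW _]; apply/nat_card_le_infinite; apply: (hW 0%N); exact: card_eqxx. Qed.

(* A connection would yield aleph_omega-many countable subsets of [W] cofinal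
   among all the countable subsets; since [W] is a countable union of smaller
   sets, this contradicts Koenig's diagonal argument. *)
Lemma aleph_omega_no_conn (A : nat -> Type) W :
  (forall n, is_aleph n (A n)) -> is_aleph_omega W ->
  ~ tukey_conn (tukey_prod (finite_rel W) dominated) (@covers_seq W).
Proof.
move=> hA hW [psi [phi h]].
have Winf := aleph_omega_infinite hW.
have [i0 i0I] := (infinite_setTP _).1 Winf.
(* The terms of all sequences whose challenge under [psi] has its finite part inside [F]. *)
pose U (F : finite_subsets W) := [set w | exists x n, ((psi x).1 <= F)%O /\ x n = w].
have Ucount F : countable (U F).
  apply: (@sub_countable _ _ _ (\bigcup_n [set w | exists x, ((psi x).1 <= F)%O /\ x n = w])).
    by apply: subset_card_le => w [x [n xw]]; exists n => //; exists x.
  (* If the [n]-th terms were uncountable in number, infinitely many of their sequences would share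
     a bound [(F, g)], and the finite set [phi (F, g) n] would contain infinitely many terms. *)
  apply: bigcup_countable => // n _; apply: contrapT => Vunc.
  pose V := {w | exists x, ((psi x).1 <= F)%O /\ x n = w}.
  have /choice[x xP] (w : V) : exists x, ((psi x).1 <= F)%O /\ x n = sval w.
    exact: svalP w.
  have [|v [g [vI vg]]] := @uncountable_dominated_subset V (fun w => (psi (x w)).2).
    by move=> /type_card_leP Vc; apply: Vunc; apply/set_card_leP.
  have fin : finite_set ((fun n => sval (v n)) @^-1` val (phi (F, g) n)).
    apply: finite_preimage; last exact: finite_setP_family.
    by move=> a b _ _ /= /sval_inj/vI.
  apply: infinite_nat; apply: sub_finite_set fin => k _ /=.
  have [xF <-] := xP (v k).
  by apply: (h (x (v k)) (F, g)); split=> //=; exact: vg.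
have /type_card_leP[j jI] := aleph_omega_card_le_sigT hA hW.
(* [W] becomes an increasing union of pieces of size at most aleph_n. *)
pose WF n := [set w | (projT1 (j w) <= n)%N].
have Ainf n := is_aleph_infinite (hA n).
have WFA n : type_card_le {w | WF n w} (A n).
  apply: (@type_card_le_trans {p : {m & A m} | (projT1 p <= n)%N}).
    apply/type_card_leP.
    exists (fun w : {w | WF n w} =>
      exist (fun p : {m & A m} => (projT1 p <= n)%N) (j (sval w)) (svalP w)).
    by move=> x y [/jI/sval_inj].
  by apply: (@sigT_nat_card_le [set m | (m <= n)%N]) => // m mn; exact: is_aleph_le.
(* There are at most aleph_n finite subsets [F] of [WF n], and each [U F] is countable, so together
   these sets miss a point of [W]. *)
have /choice[w wP] n : exists w, forall F : finite_subsets W, val F `<=` WF n -> ~ U F w.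
  apply: contrapT => no.
  have [[_ lt] _] : type_card_lt (A n) (A n.+1) /\ True.
    by split=> //; exact: is_alephS_lt.
  apply: lt; have [/(_ _ _ (hA n.+1)) AW _] := hW; apply: (type_card_le_trans AW).
  pose G : Type := finite_subsets (A n).
  have /type_card_leP[r rI] := WFA n.
  have GA : type_card_le G (A n) := infinite_card_finite_subsets (Ainf n).
  have /choice[code codeP] (F : finite_subsets W) : exists c : W -> nat,
      forall a b, U F a -> U F b -> c a = c b -> a = b.
    have /set_card_leP[c cI] := Ucount F.
    exists (fun a => if pselect (U F a) is left ha then c (exist _ a ha) else 0%N).
    by move=> a b Ua Ub; do 2 case: pselect => // ?; move=> /cI[].
  have /choice[F FP] a : exists F : finite_subsets W, val F `<=` WF n /\ U F a.
    apply: contrapT => noF; apply: no; exists a => F FW UFa.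
    by apply: noF; exists F.
  have finr (F' : finite_subsets W) : finite_set [set b | exists z, val F' (sval z) /\ r z = b].
    have fin : finite_set ((@sval W (WF n)) @^-1` val F').
      apply: finite_preimage; last exact: finite_setP_family.
      by move=> x y _ _; exact: sval_inj.
    apply: sub_finite_set (finite_image r fin) => b [z [Fz <-]].
    by exists z.
  pose e a : nat * G := (code (F a) a,
    Sub [set b | exists z, val (F a) (sval z) /\ r z = b] (mem_set (finr (F a)))).
  apply: type_card_le_trans (infinite_card_prod_nat (Ainf n)).
  apply: (@type_card_le_trans (nat * G)); last first.
    by apply: type_card_le_prod => //; exact: type_card_le_refl.
  apply/type_card_leP; exists e => a b [cab Fab].
  have FabE : F a = F b.
    apply/val_inj/seteqP; have [Fa Ua] := FP a; have [Fb Ub] := FP b.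
    split=> z Fz.
      have : [set b0 | exists z0, val (F a) (sval z0) /\ r z0 = b0] (r (exist _ z (Fa z Fz))).
        by exists (exist _ z (Fa z Fz)).
      by rewrite Fab => -[z' [Fz' /rI z'z]]; rewrite z'z in Fz'.
    have : [set b0 | exists z0, val (F b) (sval z0) /\ r z0 = b0] (r (exist _ z (Fb z Fz))).
      by exists (exist _ z (Fb z Fz)).
    by rewrite -Fab => -[z' [Fz' /rI z'z]]; rewrite z'z in Fz'.
  apply: (codeP (F a)); first by have [] := FP a.
    by rewrite FabE; have [] := FP b.
  by rewrite cab FabE.
(* The challenge of the diagonal sequence [w] has its finite part inside some [WF N], yet it puts
   [w N] into a set that [w N] avoids. *)
have [N NP] := nat_bounded_finite (finite_image (fun a => projT1 (j a))
  (finite_setP_family (psi w).1)).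
apply: (wP N (psi w).1) => [a Fa|]; first by apply: NP; exists a.
by exists w, N; split.
Qed.

(** * Hedgehogs and topological sums *)

Section MetricCriteria.
Context {R : realType} {M : topologicalType} {d : M -> M -> R}.
Hypothesis dM : compatible_metric d.

Lemma infinite_separated_not_locally_compact (x : M) :
  (forall e : R, 0 < e -> exists (S : nat -> M) (r : R), [/\ 0 < r,
     forall a, d x (S a) < e & forall a b, a <> b -> r <= d (S a) (S b)]) ->
  ~ locally_compact [set: M].
Proof.
move=> xS lc; have [U xU [Uc _]] := lc x I.
have /(nbhs_distP dM)[e e0 eU] : nbhs x U.
  by have : nbhs x [set y | setT y -> U y] := xU; apply: filterS => y; exact.
have [S [r [r0 Se Sr]]] := xS e e0; apply: infinite_nat.
apply: sub_finite_set (separated_closed_discrete dM r0 Sr Uc) => a _.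
exact/eU/Se.
Qed.

(** Basic neighbourhoods of distinct points [S a], taken inside balls of radius [e], are
    distinct. *)
Lemma separated_card_le_basis K (S : K -> M) (e : R) B : 0 < e ->
  (forall a b, a <> b -> e <= d (S a) (S b)) -> @basis M B -> [set: K] #<= B.
Proof.
move=> e0 Se [_ Bb].
have /choice[U UP] (a : K) : exists U, [/\ B U, U (S a) & forall y, U y -> d (S a) y < e].
  have [|U [BU Ua] Ue] := Bb (S a) [set y | d (S a) y < e].
    by apply/(nbhs_distP dM); exists e.
  by exists U.
apply/card_le_setP; exists U => [a b Uab|a]; last by have [] := UP a.
apply: contrapT => /Se; apply/negP; rewrite -ltNge.
by have [_ _] := UP a; apply; rewrite Uab; have [] := UP b.
Qed.

Lemma has_weight_intro J (D : J -> M) W : type_card_le (J * nat) W ->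
  (forall x (e : R), 0 < e -> exists j, d x (D j) < e) ->
  (forall B, @basis M B -> [set: W] #<= B) -> has_weight M W.
Proof.
move=> JW Dd Wmin; split=> //.
pose U (p : J * nat) := [set y | d (D p.1) y < p.2.+1%:R^-1].
have bU : basis (range U).
  split=> [_ [p _ <-]|x V /(nbhs_distP dM)[e e0 eV]].
    exact: (open_dist_ball dM).
  have e2 : 0 < e / 2 by lra.
  have [n ne] := invSn_lt e2; have [j xj] := Dd x _ (@invSn_gt0 R n).
  exists (U (j, n)); first by split; [exists (j, n)|rewrite /U /= (dist_sym dM)].
  move=> y; rewrite /U /= => jy; apply: eV.
  have := dist_tri dM (D j) x y.
  by move: (n.+1%:R^-1) ne xj jy => s ? ? ? ?; lra.
exists (range U) => //; apply/card_eqPle; split; last exact: Wmin.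
exact: card_le_trans (card_image_le _ _) JW.
Qed.

End MetricCriteria.

Section RealSegment.
Import numFieldNormedType.Exports.
Context {R : realType}.

Lemma real_dist_compatible : compatible_metric (fun x y : R => `|x - y|).
Proof.
split; first split.
- by move=> x y; split=> [/normr0_eq0/subr0_eq|->] //; rewrite subrr normr0.
- exact: distrC.
- by move=> y x z; exact: ler_distD.
by move=> x; rewrite -filter_from_ballE.
Qed.

Lemma segment_cluster_seq (a b : R) (x : nat -> R) :
  (forall n, a <= x n <= b) -> exists2 z, a <= z <= b &
    forall e : R, 0 < e -> forall N, exists2 n, (N <= n)%N & `|z - x n| < e.
Proof.
move=> xab.
have [N|z] := compact_cluster_seq real_dist_compatible (u := x) (@segment_compact R a b).
  by exists N => //=; rewrite in_itv /=; exact: xab.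
rewrite /= in_itv /= => zab zP; exists z => // e e0 N.
by have [n [Nn _ zn]] := zP e e0 N; exists n.
Qed.

End RealSegment.

Section Hedgehog.
Context {R : realType}.
Local Notation unit_interval := {x : R | 0 < x <= 1}.

Lemma hedgehog_compatible K : compatible_metric (@hedgehog_dist R K).
Proof.
split; first split.
- by move=> x y; split=> [|->]; [exact: hedgehog_dist_eq0|exact: hedgehog_distxx].
- exact: hedgehog_dist_sym.
- exact: hedgehog_dist_triangle.
by move=> x; rewrite -filter_from_ballE.
Qed.

Lemma hedgehog_dist_le2 K (p q : hedgehog R K) : hedgehog_dist p q <= 2.
Proof.
have := hedgehog_dist_triangle None p q; rewrite (hedgehog_dist_sym p None).
have le1 (r : hedgehog R K) : hedgehog_dist None r <= 1.
  by case: r => [[[x /andP[_ x1]] a]|] /=.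
by have := le1 p; have := le1 q; lra.
Qed.

(** A Cauchy sequence that does not cluster at the centre eventually stays on one spine, at heights
    in a segment [[e, 1]], where it clusters. *)
Lemma hedgehog_complete K (u : nat -> hedgehog R K) :
  cauchy_seq hedgehog_dist u -> exists x : hedgehog R K, u @ \oo --> x.
Proof.
move=> uc; have hM := hedgehog_compatible K.
have [near0|] := pselect (forall e : R, 0 < e -> forall N, exists n,
    (N <= n)%N /\ hedgehog_dist None (u n) < e).
  by exists None; exact: (cauchy_cluster_cvg hM).
move=> /existsNP[e /not_implyP[e0 /existsNP[N /forallNP far]]].
have {}far n : (N <= n)%N -> e <= hedgehog_dist None (u n).
  by move=> Nn; rewrite leNgt; apply/negP => ?; apply: (far n).
have [N' N'P] := uc e e0; pose m := maxn N N'.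
have [xm [a um]] : exists x a, u m = Some (x, a).
  move: (far m (leq_maxl _ _)); case: (u m) => [[x a]|] /=; first by exists x, a.
  by rewrite leNgt e0.
(* From [m] on, distances are below [e], whereas points of height at least [e] on different spines
   are at least [2 * e] apart. *)
have spine n : exists x : unit_interval, (m <= n)%N -> u n = Some (x, a) /\ e <= val x.
  have [mn|] := boolP (m <= n)%N; last by exists xm.
  have Nn := leq_trans (leq_maxl N N') mn; have N'n := leq_trans (leq_maxr N N') mn.
  have := N'P _ _ (leq_maxr N N') N'n; rewrite -/m um.
  have := far _ (leq_maxl N N'); rewrite -/m um.
  have := far _ Nn; case: (u n) => [[x b]|] /=; last by rewrite leNgt e0.
  case: pselect => /= [ab ? _ _|_]; first by exists x; rewrite ab.
  by move: (sval x) (sval xm) => ? ?; lra.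
have /choice[x xP] := spine.
have [n|z /andP[ez z1] zP] := @segment_cluster_seq _ e 1 (fun n => val (x (m + n)%N)).
  by have [_ ->] := xP _ (leq_addr n m); case: (x _) => y /= /andP[].
have z0 : 0 < z <= 1 by rewrite (lt_le_trans e0 ez).
exists (Some (exist _ z z0, a)); apply: (cauchy_cluster_cvg hM) => // r r0 k.
have [n kn zn] := zP r r0 k; exists (m + n)%N; split.
  exact: leq_trans (leq_addl _ _).
have [-> _] := xP _ (leq_addr n m).
by rewrite /=; case: pselect.
Qed.

Fact level_subproof n : 0 < (n.+1%:R^-1 : R) <= 1.
Proof. by rewrite invSn_gt0 invf_le1 ?ler1n. Qed.

Definition level n : unit_interval := exist _ (n.+1%:R^-1) (level_subproof n).

Definition spoke K n (a : K) : hedgehog R K := Some (level n, a).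

Lemma spoke_dist K n (a b : K) : a <> b ->
  n.+1%:R^-1 <= hedgehog_dist (spoke n a) (spoke n b).
Proof.
by move=> ab; rewrite /spoke /=; case: pselect => //= _; rewrite lerDl ltW ?invSn_gt0.
Qed.

(** The points [spoke n (x n)] converge to the centre, so they form a compact set with it.
    Conversely, for each [n] the points [spoke n a] are separated, so a compact set contains
    finitely many of them. *)
Lemma hedgehog_covers_seq K :
  tukey_conn (compact_rel (hedgehog R K)) (@covers_seq K).
Proof.
have hM := hedgehog_compatible K.
have /choice[phi phiP] (L : set (hedgehog R K)) : exists F : nat -> finite_subsets K,
    compact L -> forall n a, L (spoke n a) -> val (F n) a.
  have [Lc|nL] := pselect (compact L); last first.
    by exists (fun=> Sub set0 (mem_set (finite_set0 K)) : finite_subsets K).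
  have fin n : finite_set [set a | L (spoke n a)].
    exact: (separated_closed_discrete hM (@invSn_gt0 R n) (@spoke_dist K n) Lc).
  by exists (fun n => Sub [set a | L (spoke n a)] (mem_set (fin n)) : finite_subsets K).
apply: (@tukey_conn_from_family _ _ _ _ _
  (fun x : nat -> K => [set None] `|` \bigcup_n [set spoke n (x n)]) phi).
  move=> x; apply: compact_converging => [n|U /(nbhs_distP hM)[e e0 eU]].
    exact: compact_set1.
  have [N Ne] := invSn_lt e0; exists N => n Nn _ ->; apply: eU => /=.
  exact: le_lt_trans (invSn_le Nn) Ne.
move=> x L Lc xL n; apply: phiP => //; apply: xL; right.
by exists n.
Qed.

Lemma unit_interval_dense : exists r : nat -> unit_interval,
  forall (x : unit_interval) (e : R), 0 < e -> exists n, `|val x - val (r n)| < e.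
Proof.
have [u uS] := rat_enumeration.
exists (fun n => if pselect (0 < (ratr (u n) : R) <= 1) is left h
  then exist _ (ratr (u n)) h else level 0) => x e e0.
have /andP[x0 x1] := valP x.
(* The rational is sought below [x], so that it stays at most 1. *)
have lt : Num.max 0 (val x - e) < val x by rewrite gt_max x0 /=; lra.
have [q] := rat_in_itvoo lt; rewrite in_itv /= gt_max => /andP[/andP[q0 qx] qx'].
have [n nq] := uS q; exists n; rewrite nq.
have q01 : 0 < (ratr q : R) <= 1 by rewrite q0 (le_trans (ltW qx') x1).
case: pselect => //= _; rewrite gtr0_norm ?subr_gt0 //.
by move: qx; move: (sval x) (ratr q) => ? ?; lra.
Qed.

Lemma hedgehog_dense K (k0 : K) : exists D : nat * K -> hedgehog R K,
  forall x (e : R), 0 < e -> exists j, hedgehog_dist x (D j) < e.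
Proof.
have [r rd] := unit_interval_dense.
exists (fun p => Some (r p.1, p.2)) => -[[x a]|] e e0.
  have [n xn] := rd x e e0; exists (n, a) => /=.
  by case: pselect.
have e2 : 0 < e / 2 by lra.
have [n ne] := invSn_lt e2; have [m nm] := rd (level n) _ e2.
exists (m, k0) => /=; move: ne nm; rewrite /level /=.
move: (n.+1%:R^-1) (\val (r m)) => a b.
by case: ger0P => ? ? ?; lra.
Qed.

Lemma hedgehog_not_locally_compact K : infinite_set [set: K] ->
  ~ locally_compact [set: hedgehog R K].
Proof.
move=> /infinite_setTP[i iI].
apply: (infinite_separated_not_locally_compact (hedgehog_compatible K) (x := None)).
move=> e e0; have [n ne] := invSn_lt e0.
exists (fun m => spoke n (i m)), n.+1%:R^-1; split=> //.
by move=> a b ab; apply: spoke_dist => /iI.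
Qed.

Lemma hedgehog_has_weight K : infinite_set [set: K] -> has_weight (hedgehog R K) K.
Proof.
move=> Kinf; have [k0 _] := infinite_setN0 Kinf.
have [D Dd] := hedgehog_dense k0.
apply: (has_weight_intro (hedgehog_compatible K) (D := D)) => //.
  apply: type_card_le_trans (infinite_card_square Kinf).
  apply: type_card_le_prod; last exact/nat_card_le_infinite.
  exact: infinite_card_prod_nat.
move=> B; apply: (separated_card_le_basis (hedgehog_compatible K)
  (@invSn_gt0 R 0) (@spoke_dist K 0)).
Qed.

End Hedgehog.

Section SigmaMetric.
Context {R : realType} {X : nat -> topologicalType} {d : forall n, X n -> X n -> R}.
Hypothesis dX : forall n, compatible_metric (@d n).
Hypothesis d_le2 : forall n x y, @d n x y <= 2.

(** The bound [d_le2] makes the distance 2 between summands compatible with the triangle inequality,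
    and balls of radius 2 stay in one summand. *)
Definition sigma_dist (p q : {n & X n}) : R :=
  if pselect (projT1 p = projT1 q) is left e
  then d (eq_rect _ X (projT2 p) _ e) (projT2 q) else 2.

Lemma sigma_distE n (x y : X n) : sigma_dist (existT _ n x) (existT _ n y) = d x y.
Proof. by rewrite /sigma_dist; case: pselect => //= e; rewrite (eq_axiomK e). Qed.

Lemma sigma_dist_lt2 p q : sigma_dist p q < 2 -> projT1 p = projT1 q.
Proof. by rewrite /sigma_dist; case: pselect => //= _; rewrite ltxx. Qed.

Lemma sigma_dist_neq p q : projT1 p <> projT1 q -> sigma_dist p q = 2.
Proof. by rewrite /sigma_dist; case: pselect. Qed.

Lemma sigma_dist_compatible : compatible_metric sigma_dist.
Proof.
have dge0 p q : 0 <= sigma_dist p q.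
  by rewrite /sigma_dist; case: pselect => // e; exact: (dist_ge0 (dX _)).
have dle2 p q : sigma_dist p q <= 2.
  by rewrite /sigma_dist; case: pselect => // e; exact: d_le2.
split; first split.
- move=> [n x] [m y]; split=> [xy|->]; last by rewrite sigma_distE (distxx (dX _)).
  have /= nm : n = m by apply: (@sigma_dist_lt2 (existT _ n x) (existT _ m y)); rewrite xy.
  by subst m; move: xy; rewrite sigma_distE => /(dist_eq0 (dX _)) ->.
- move=> [n x] [m y]; have [nm|nm] := pselect (n = m).
    by subst m; rewrite !sigma_distE (dist_sym (dX _)).
  by rewrite !sigma_dist_neq //= => /esym.
- move=> [m y] [n x] [k z]; have [nm|nm] := pselect (n = m); last first.
    rewrite (@sigma_dist_neq (existT _ n x) (existT _ m y)) //.
    by rewrite (le_trans (dle2 _ _)) // lerDl.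
  have [mk|mk] := pselect (m = k); last first.
    rewrite (@sigma_dist_neq (existT _ m y) (existT _ k z)) //.
    by rewrite (le_trans (dle2 _ _)) // lerDr.
  by subst m k; rewrite !sigma_distE; exact: (dist_tri (dX _)).
move=> [n x]; apply/seteqP; split=> U.
  move=> /(nbhs_distP (dX n))[e e0 eU].
  exists (Num.min e 2); first by rewrite /= lt_min e0 /=.
  move=> [m y] /=; rewrite lt_min => /andP[xy /sigma_dist_lt2 /= nm]; subst m.
  by apply: eU; rewrite -sigma_distE.
move=> [e e0 eU]; apply/(nbhs_distP (dX n)); exists e => // y xy.
by apply: eU; rewrite /= sigma_distE.
Qed.

Lemma sigma_complete :
  (forall n (u : nat -> X n), cauchy_seq (@d n) u -> exists x : X n, u @ \oo --> x) ->
  forall u : nat -> {n & X n}, cauchy_seq sigma_dist u ->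
  exists x : {n & X n}, u @ \oo --> x.
Proof.
move=> dc u uc; have [N NP] := uc 2 (ltr0Sn _ _).
have fibre n : exists x : X (projT1 (u N)), (N <= n)%N -> u n = existT X _ x.
  have [Nn|] := boolP (N <= n)%N; last by exists (projT2 (u N)).
  have := sigma_dist_lt2 (NP _ _ (leqnn N) Nn).
  case: (u n) => [m y] /= E; subst m.
  by exists y.
have /choice[v vP] := fibre.
have vE k : u (N + k)%N = existT X _ (v (N + k)%N) by apply: vP; exact: leq_addr.
have [|x vx] := dc _ (fun k => v (N + k)%N).
  move=> e /uc[N1 N1P]; exists N1 => m n Nm Nn.
  have := N1P (N + m)%N (N + n)%N (leq_trans Nm (leq_addl _ _)) (leq_trans Nn (leq_addl _ _)).
  by rewrite !vE sigma_distE.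
exists (existT X _ x); apply/(cvg_distP sigma_dist_compatible) => e e0.
have [k kP] := (cvg_distP (dX _) _ _).1 vx e e0.
exists (N + k)%N => n Nkn; have Nn := leq_trans (leq_addr k N) Nkn.
rewrite -(subnKC Nn) vE sigma_distE; apply: kP.
by rewrite leq_subRL.
Qed.

(** The summands are open, so finitely many of them cover a compact set. *)
Lemma sigma_compact_bounded L : compact (L : set {n & X n}) ->
  exists N, forall p, L p -> (projT1 p <= N)%N.
Proof.
move=> Lc.
have [p Lp|s sL] := compact_finite_subcover (C := fun n => [set p : {n & X n} | projT1 p = n]) Lc.
  exists (projT1 p); apply/(nbhs_distP sigma_dist_compatible).
  by exists 2 => // q /sigma_dist_lt2.
have [N NP] := nat_bounded_finite (seq_finite_set s).
by exists N => p /sL[n [/NP nN pn]]; rewrite (pn : projT1 p = n).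
Qed.

End SigmaMetric.

(** * The sum of the hedgehogs *)

Section HedgehogSum.
Context {R : realType} (A : nat -> Type) (W : Type).
Hypothesis hA : forall n, is_aleph n (A n).
Hypothesis hW : is_aleph_omega W.

Definition hedgehog_sum : topologicalType := {n : nat & hedgehog R (A n)}.

Definition hedgehog_sum_dist : hedgehog_sum -> hedgehog_sum -> R :=
  @sigma_dist R (fun n => hedgehog R (A n)) (fun n => @hedgehog_dist R (A n)).

Let in_sum n (x : hedgehog R (A n)) : hedgehog_sum :=
  existT (fun n => hedgehog R (A n)) n x.

Lemma hedgehog_sum_compatible : compatible_metric hedgehog_sum_dist.
Proof.
apply: (@sigma_dist_compatible R (fun n => hedgehog R (A n))).
  by move=> n; exact: hedgehog_compatible.
by move=> n; exact: hedgehog_dist_le2.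
Qed.

Lemma hedgehog_sum_distE n (x y : hedgehog R (A n)) :
  hedgehog_sum_dist (in_sum x) (in_sum y) = hedgehog_dist x y.
Proof. exact: (@sigma_distE R (fun n => hedgehog R (A n))). Qed.

Lemma hedgehog_sum_complete u : cauchy_seq hedgehog_sum_dist u ->
  exists x : hedgehog_sum, u @ \oo --> x.
Proof.
apply: (@sigma_complete R (fun n => hedgehog R (A n))).
- by move=> n; exact: hedgehog_compatible.
- by move=> n; exact: hedgehog_dist_le2.
- by move=> n; exact: hedgehog_complete.
Qed.

Lemma hedgehog_sum_not_locally_compact : ~ locally_compact [set: hedgehog_sum].
Proof.
have [i iI] := (infinite_setTP _).1 (is_aleph_infinite (hA 0%N)).
apply: (infinite_separated_not_locally_compact hedgehog_sum_compatible
  (x := in_sum (None : hedgehog R (A 0%N)))).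
move=> e e0; have [n ne] := invSn_lt e0.
exists (fun m => in_sum (spoke n (i m))), n.+1%:R^-1; split=> //.
  by move=> a; rewrite hedgehog_sum_distE.
by move=> a b ab; rewrite hedgehog_sum_distE; apply: spoke_dist => /iI.
Qed.

Lemma aleph_card_le_omega n : type_card_le (A n) W.
Proof. by have [AW _] := hW; exact: AW (hA n). Qed.

Lemma hedgehog_sum_has_weight : has_weight hedgehog_sum W.
Proof.
have Winf := aleph_omega_infinite hW.
have Dex n : exists D : nat * A n -> hedgehog R (A n),
    forall x (e : R), 0 < e -> exists j, hedgehog_dist x (D j) < e.
  by have [k0 _] := infinite_setN0 (is_aleph_infinite (hA n)); exact: hedgehog_dense k0.
pose D n := projT1 (cid (Dex n)).
have Dd n x (e : R) : 0 < e -> exists j, hedgehog_dist x (D n j) < e.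
  exact: (projT2 (cid (Dex n))).
apply: (has_weight_intro hedgehog_sum_compatible
  (D := fun p : {n & (nat * A n)%type} => in_sum (D (projT1 p) (projT2 p)))).
- apply: type_card_le_trans (infinite_card_square Winf).
  apply: type_card_le_prod; last exact/nat_card_le_infinite.
  apply: (@type_card_le_trans {p : {n & (nat * A n)%type} | [set: nat] (projT1 p)}).
    by apply/type_card_leP; exists (fun p => exist _ p I) => x y [].
  apply: sigT_nat_card_le => // n _; apply: type_card_le_trans (infinite_card_prod_nat Winf).
  by apply: type_card_le_prod (aleph_card_le_omega n); exact: type_card_le_refl.
- move=> [n x] e e0; have [j xj] := Dd n x e e0.
  by exists (existT _ n j); rewrite (hedgehog_sum_distE x).
(* The separated points [spoke 0 a] of the [n]-th summand give [B] at least aleph_n elements for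
   every [n], hence at least aleph_omega. *)
- move=> B bB; apply/card_le_sigP; apply: hW.2 => n K nK.
  apply: (type_card_le_trans (is_aleph_card_le nK (hA n))).
  apply: (card_le_sigP B (A n)).1.
  apply: (separated_card_le_basis hedgehog_sum_compatible
    (S := fun a : A n => in_sum (spoke 0 a)) (@invSn_gt0 R 0)) => // a b ab.
  by rewrite hedgehog_sum_distE; exact: spoke_dist.
Qed.

(* A compact subset lives in finitely many summands, which have a dense set of
   size aleph_n, and the countable subsets of aleph_n have cofinality aleph_n. *)
Lemma hedgehog_sum_conn :
  tukey_conn (tukey_prod (finite_rel W) dominated) (compact_rel hedgehog_sum).
Proof.
have Winf := aleph_omega_infinite hW.
have Ainf n := is_aleph_infinite (hA n).
pose I := {n & (nat * A n)%type}.
have Dex n : exists D : nat * A n -> hedgehog R (A n),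
    forall x (e : R), 0 < e -> exists j, hedgehog_dist x (D j) < e.
  by have [k0 _] := infinite_setN0 (Ainf n); exact: hedgehog_dense k0.
pose D n := projT1 (cid (Dex n)).
have Dd n x (e : R) : 0 < e -> exists j, hedgehog_dist x (D n j) < e.
  exact: (projT2 (cid (Dex n))).
(* The dense points of the first [N + 1] summands can be indexed by aleph_N. *)
have gex N : exists g : A N -> I, forall p : I, (projT1 p <= N)%N -> exists a, g a = p.
  have /type_card_leP[f fI] : type_card_le {p : I | (projT1 p <= N)%N} (A N).
    apply: (@sigT_nat_card_le [set n | (n <= N)%N]) => // n nN.
    apply: type_card_le_trans (infinite_card_prod_nat (Ainf N)).
    by apply: type_card_le_prod; [exact: type_card_le_refl|exact: is_aleph_le].
  have [k0 _] := infinite_setN0 (Ainf N).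
  have [g gf] := exists_left_inverse (existT _ N (0%N, k0) : I) fI.
  by exists g => p pN; exists (f (exist _ p pN)); rewrite gf.
pose g N := projT1 (cid (gex N)).
have gP N (p : I) : (projT1 p <= N)%N -> exists a, g N a = p.
  exact: (projT2 (cid (gex N))).
have cex N := is_aleph_countable_cofinal (hA N).
pose c N := projT1 (cid (cex N)).
have cP N (s : nat -> A N) : exists k, forall i, exists j, c N k j = s i.
  exact: (projT2 (cid (cex N))).
pose DI (p : I) := in_sum (D (projT1 p) (projT2 p)).
(* The index [(N, k)] names the [k]-th sequence of such points in the first [N + 1] summands; there
   are aleph_omega many indices. *)
pose c' (j : {N & A N}) k := DI (g _ (c _ (projT2 j) k)).
have JW : type_card_le {N & A N} W.
  apply: (@type_card_le_trans {p : {n & A n} | [set: nat] (projT1 p)}).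
    by apply/type_card_leP; exists (fun p => exist _ p Logic.I) => x y [].
  by apply: sigT_nat_card_le => // n _; exact: aleph_card_le_omega.
have : tukey_conn (tukey_prod (finite_rel W) dominated)
    (tukey_prod (finite_rel {N & A N}) dominated).
  by apply: tukey_conn_prod; [exact: finite_rel_card_le|exists id, id].
move=> /tukey_conn_trans; apply; apply: baire_covers_conn.
apply: (complete_baire_covers hedgehog_sum_compatible hedgehog_sum_complete (c := c')).
move=> L Lc.
have [N LN] : exists N, forall p, L p -> (projT1 p <= N)%N.
  apply: (@sigma_compact_bounded R (fun n => hedgehog R (A n))
    (fun n => @hedgehog_dist R (A n))) => //.
    by move=> n; exact: hedgehog_compatible.
  by move=> n; exact: hedgehog_dist_le2.
have [k0 _] := infinite_setN0 (Ainf N).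
have [|s sP] := compact_countable_approximation hedgehog_sum_compatible
    (D := fun a => DI (g N a)) k0 Lc.
  move=> [n x] e /LN /= nN e0; have [j xj] := Dd n x e e0.
  have [a ga] := gP N (existT _ n j) nN.
  by exists a; rewrite ga /DI /= (hedgehog_sum_distE x).
have [k kP] := cP N s; exists (existT _ N k) => x e Lx e0.
have [m xm] := sP x e Lx e0; have [i im] := kP m.
by exists i; rewrite /c' /= im.
Qed.

End HedgehogSum.

(** * The four assertions assembled from the upper and lower bounds *)

Theorem theorem36 (R : realType) (D W : Type) (A : nat -> Type)
  (hD : is_dominating_number D)
  (hA : forall n, is_aleph n (A n))
  (hW : is_aleph_omega W) :
  (forall (M N : topologicalType) (K : Type),
     metrizable R M -> metrizable R N ->
     has_weight M K -> has_weight N K -> ~ countable [set: K] ->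
     [/\ (type_card_lt K D ->
            (locally_compact [set: M] <->
             tukey_eq (compacts M) (finite_subsets K))),
         (~ locally_compact [set: M] \/ type_card_le D K ->
            tukey_eq (compacts M) (compacts (M * rat^o)%type)) /\
         (metrizable R (M * rat^o)%type /\
          ~ completely_metrizable R (M * rat^o)%type) &
         (type_card_lt K W ->
            completely_metrizable R M -> ~ locally_compact [set: M] ->
            completely_metrizable R N -> ~ locally_compact [set: N] ->
            tukey_eq (compacts M) (compacts N))]) /\
  (let M' : topologicalType := {n : nat & hedgehog R (A n)} in
   let M'' : topologicalType := hedgehog R W in
   [/\ [/\ completely_metrizable R M', ~ locally_compact [set: M'] &
           has_weight M' W],
       [/\ completely_metrizable R M'', ~ locally_compact [set: M''] &
           has_weight M'' W] &
       ~ tukey_eq (compacts M') (compacts M'')]).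
Proof.
have Winf := aleph_omega_infinite hW.
split=> [M N K [d dM] [d' dN] MK NK Kunc|M' M'']; last first.
  split.
  - split; [|exact: hedgehog_sum_not_locally_compact|exact: hedgehog_sum_has_weight].
    exists (@hedgehog_sum_dist R A); first exact: hedgehog_sum_compatible.
    exact: hedgehog_sum_complete.
  - split; [|exact: hedgehog_not_locally_compact|exact: hedgehog_has_weight].
    exists hedgehog_dist; first exact: hedgehog_compatible.
    exact: hedgehog_complete.
  - move=> [/tukey_geP M'M'' _]; apply: (aleph_omega_no_conn hA hW).
    apply: tukey_conn_trans (hedgehog_sum_conn (R := R) hA hW) _.
    exact: tukey_conn_trans M'M'' (hedgehog_covers_seq _).
have Kinf : infinite_set [set: K] by move=> /finite_set_countable.
split.
- move=> [_ DK]; split=> [lc|[/tukey_geP _ /tukey_geP KM]].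
    have [S SP] := locally_compact_closed_discrete dM MK Kunc lc.
    split; apply/tukey_geP.
      exact: (closed_discrete_finite_rel SP).
    exact: (locally_compact_finite_rel MK lc).
  (* Without local compactness, the finite subsets of [K] would lie Tukey above omega^omega, which
     forces [D] to be at most [K]. *)
  apply: contrapT => nlc; apply: DK.
  apply: (finite_rel_dominated_card_le hD Kinf).
  exact: tukey_conn_trans KM (not_locally_compact_dominated dM nlc).
- have [x _] := uncountable_weight_nonempty MK Kunc.
  split; last first.
    split; first by exists (@prod_rat_dist R M d); exact: prod_rat_dist_compatible.
    exact: (prod_rat_not_completely_metrizable dM x).
  move=> nlc; have Mdom : tukey_conn (compact_rel M) dominated.
    have [lc|] := pselect (locally_compact [set: M]); last first.
      exact: (not_locally_compact_dominated dM).
    have DK : type_card_le D K by case: nlc.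
    have [S SP] := locally_compact_closed_discrete dM MK Kunc lc.
    apply: tukey_conn_trans (closed_discrete_finite_rel SP) _.
    exact: dominating_finite_rel hD DK.
  (* An uncountable separated set suffices here, since the upper bound for the rationals holds over
     any uncountable index set. *)
  have [//|e [S [e0 Se Sunc]]] := large_separated_set dM MK infinite_nat.
  have MS : tukey_conn (compact_rel M) (finite_rel {x | S x}).
    apply: (closed_discrete_finite_rel (S := sval)).
    apply: (separated_closed_discrete dM e0) => y z yz.
    by apply: Se; [exact: svalP y|exact: svalP z|move=> /sval_inj].
  split; apply/tukey_geP; last exact: compact_prod_fst_conn (0 : rat^o).
  apply: tukey_conn_trans (compact_prod_conn _ _).
  apply: tukey_conn_directed_prod; first by exists id, id.
  apply: tukey_conn_trans (uncountable_rat_conn (R := R) Sunc).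
  exact: tukey_conn_directed_prod.
- move=> KW cM nM cN nN.
  have [[|n] nK] := lt_aleph_omega_aleph hW KW Kinf.
    by case: Kunc; move: nK => /card_eqPle[].
  have down (X : topologicalType) : has_weight X K -> completely_metrizable R X ->
      ~ locally_compact [set: X] ->
      tukey_conn (compact_rel X) (tukey_prod (finite_rel K) dominated) /\
      tukey_conn (tukey_prod (finite_rel K) dominated) (compact_rel X).
    move=> XK [dX XM Xc] nX; split; last exact: (complete_aleph_conn XM Xc XK Kunc nK).
    apply: tukey_conn_directed_prod; last exact: not_locally_compact_dominated XM nX.
    (* The index is a successor, so a separated set that does not embed into the predecessor [L]
       already has size at least [K]. *)
    case: nK => L nL LK.
    have [|e [S [e0 Se SL]]] := large_separated_set XM XK (is_aleph_infinite nL).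
      by case: LK => -[].
    have /type_card_leP[i iI] : type_card_le K {x | S x}.
      by apply: LK.2; exact/type_card_ltNge.
    apply: (closed_discrete_finite_rel (S := fun a => sval (i a))).
    apply: (separated_closed_discrete XM e0) => a b ab.
    by apply: Se; [exact: svalP (i a)|exact: svalP (i b)|move=> /sval_inj/iI].
  have [M1 M2] := down M MK cM nM; have [N1 N2] := down N NK cN nN.
  by split; apply/tukey_geP; [exact: tukey_conn_trans M1 N2|exact: tukey_conn_trans N1 M2].
Qed.
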